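(* Fix integers $c\ge 2$ and $r\ge 3$, let $\bm a=(a_1,\dots,a_r)\in\{1,\dots,c-1\}^r$ be an admissible $r$-palette, and let $\theta_1,\dots,\theta_{c-1}>0$ be such that $\sum_{b\in S(\bm a)}w_b\theta_b=2$ and $\theta_{\max}=1$. Then, as $n\to\infty$, $$X_{r,n}(\bm a)\xrightarrow{D}\sum_{x\in\mathcal P}N_x,$$ where $\mathcal P$ is a Poisson point process on $[0,1]$ with rate $1$ and, conditional on $\mathcal P$, the random variables $\{N_x\}_{x\in\mathcal P}$ are independent with $N_x\sim\mathrm{Pois}(\lambda_{\bm a}(x))$.
   Context: Notation: $[n]=\{1,\dots,n\}$. An $r$-AP in $[n]$ is an ordered tuple $\bm x=(x,x+d,\dots,x+(r-1)d)$ with $d\ge 1$ an integer and all entries in $[n]$. An $r$-palette is an ordered sequence $\bm a=(a_1,\dots,a_r)\in[c]^r$; it is admissible if $\bm a\in[c-1]^r$. Given a coloring $\phi_n:[n]\to[c]$, an $r$-AP is $\bm a$-colorful if $\phi_n(x+(s-1)d)=a_s$ for every $s\in[r]$. Random coloring: with fixed $\theta_1,\dots,\theta_{c-1}>0$ and $n$ large, each element of $[n]$ is independently assigned color $b\in[c]$ with probability $p_b$, where $p_b=n^{-\theta_b}$ for $b\in[c-1]$ and $p_c=1-\sum_{b=1}^{c-1}p_b$. $X_{r,n}(\bm a)$ is the number of $\bm a$-colorful $r$-APs in $[n]$ under this random coloring. $S(\bm a)$ is the set of distinct colors appearing in $\bm a$, $w_b$ is the number of times color $b\in S(\bm a)$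 appears in $\bm a$, and $\theta_{\max}=\max_{b\in S(\bm a)}\theta_b$. When $\sum_{b\in S(\bm a)}w_b\theta_b=2$ and $\theta_{\max}=1$ there is a unique index $\hat s\in[r]$ (the rare coordinate) with $\theta_{a_{\hat s}}=\theta_{\max}=1$. The function $\lambda_{\bm a}:[0,1]\to[0,\infty)$ is $$\lambda_{\bm a}(x)=\min\left\{\frac{x}{\hat s-1},\frac{1-x}{r-\hat s}\right\},$$ where, if one of the two terms has zero denominator (i.e. $\hat s=1$ or $\hat s=r$), $\lambda_{\bm a}(x)$ is defined to be the other term. $\mathrm{Pois}(0)$ is the point mass at $0$. *)

(* Defs.v *)
From HB Require Import structures.
From mathcomp Require Export all_boot all_order all_algebra.
From mathcomp Require Export finmap.
From mathcomp Require Export all_classical all_reals all_analysis.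
Export Order.TTheory GRing.Theory Num.Theory.
Export numFieldNormedType.Exports.

Set Implicit Arguments.
Unset Strict Implicit.
Unset Printing Implicit Defensive.

Local Open Scope classical_set_scope.
Local Open Scope ring_scope.

(* Indices are shifted down by one throughout: i : 'I_n stands for i + 1 in
   [n], b : 'I_c for the colour b + 1 and s : 'I_r for the coordinate s + 1.
   The colours 1, ..., c - 1 are the elements of 'I_c.-1, so an admissible
   r-palette is a map 'I_r -> 'I_c.-1; in 'I_c the colour c is the one of
   value c.-1. *)

Definition admissible_palette c r (a : 'I_r -> 'I_c.-1) : 'I_r -> 'I_c :=
  fun s => widen_ord (leq_pred c) (a s).

Definition is_AP n r (t : {ffun 'I_r -> 'I_n}) : Prop :=
  exists x d : nat, (0 < d)%N /\ forall s : 'I_r, t s = (x + s * d)%N :> nat.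

Definition colorful n r c (f : 'I_n -> 'I_c) (a : 'I_r -> 'I_c)
    (t : {ffun 'I_r -> 'I_n}) : Prop :=
  forall s : 'I_r, f (t s) = a s.

Definition num_colorful_APs n r c (f : 'I_n -> 'I_c) (a : 'I_r -> 'I_c) : nat :=
  #|[pred t : {ffun 'I_r -> 'I_n} | `[< is_AP t /\ colorful f a t >]]|.

Section palette.
Context (R : realType) (c r : nat).
Implicit Types (a : 'I_r -> 'I_c.-1) (theta : 'I_c.-1 -> R).

Definition palette_colors a : {set 'I_c.-1} := [set b in codom a]%SET.

Definition multiplicity a (b : 'I_c.-1) : nat := #|[pred s | a s == b]|.

Definition theta_max theta a : R :=
  \big[Num.max/0]_(b in palette_colors a) theta b.

Definition rare_coordinate theta a (s : 'I_r) : Prop :=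
  theta (a s) = theta_max theta a.

Definition lambda (s : 'I_r) (x : R) : R :=
  if s == 0%N :> nat then (1 - x) / (r.-1 - s)%:R
  else if s == r.-1 :> nat then x / s%:R
  else Num.min (x / s%:R) ((1 - x) / (r.-1 - s)%:R).

Definition color_prob theta (n : nat) (b : 'I_c) : R :=
  if (insub (val b) : option 'I_c.-1) is Some b' then n%:R `^ (- theta b')
  else 1 - \sum_(b' < c.-1) n%:R `^ (- theta b').

End palette.

(* Random elements of a countable type T carrying the discrete
   sigma-algebra. *)
Section discrete_random_elements.
Context d (Omega : measurableType d) (R : realType) (P : probability Omega R).

Definition discrete_measurable_fun (T : Type) (Y : Omega -> T) : Prop :=
  forall B : set T, measurable (Y @^-1` B).

Definition discrete_independent (I : finType) (T : Type) (Y : I -> Omega -> T)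
    : Prop :=
  forall (J : {set I}) (B : I -> set T),
    P (\bigcap_(i in [set` J]) Y i @^-1` B i) =
    (\prod_(i in J) P (Y i @^-1` B i))%E.

Definition random_coloring c (theta : 'I_c.-1 -> R) (n : nat)
    (phi : Omega -> 'I_n -> 'I_c) : Prop :=
  [/\ forall i : 'I_n, discrete_measurable_fun (phi^~ i),
      forall (i : 'I_n) (b : 'I_c),
        P [set w | phi w i = b] = (color_prob theta n b)%:E
    & discrete_independent (fun (i : 'I_n) w => phi w i)].

End discrete_random_elements.

(* Pois rate 0 is the point mass at 0.  The second argument of poisson_prob is
   a dummy.  The library's poisson_pmf must not be used for a zero rate: it is
   then constantly 1. *)
Definition Pois (R : realType) (rate : R) : probability nat R :=
  poisson_prob rate 0%N.

Section point_process.
Context d (Omega : measurableType d) (R : realType) (P : probability Omega R).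
Implicit Types (PP : Omega -> {fset R}) (N : Omega -> R -> nat).

Definition num_points PP (B : set R) (w : Omega) : nat :=
  count (fun x => x \in B) (PP w).

Definition poisson_point_process (D : set R) (rate : R) PP : Prop :=
  [/\ forall w x, x \in PP w -> D x,
      forall B : set R, measurable B -> B `<=` D ->
        discrete_measurable_fun (num_points PP B),
      forall B : set R, measurable B -> B `<=` D ->
        (lebesgue_measure B < +oo)%E ->
        forall k : nat, P [set w | num_points PP B w = k] =
          Pois (rate * fine (lebesgue_measure B)) [set k]
    & forall (m : nat) (B : 'I_m -> set R),
        (forall j, measurable (B j)) -> (forall j, B j `<=` D) ->
        trivIset setT B ->
        discrete_independent P (fun j => num_points PP (B j))].

Definition sigma_process PP : set (set Omega) :=
  <<s [set E | exists (B : set R) (k : nat),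
         measurable B /\ E = [set w | num_points PP B w = k]] >>.

Definition sorted_points PP (w : Omega) : seq R := sort <=%R (PP w).

Definition marks PP N (w : Omega) : seq nat :=
  [seq N w x | x <- sorted_points PP w].

(* Conditionally on PP, the N w x, x in PP w, are independent with laws
   Pois (lam x): the conditional probability, given the sigma-algebra of PP,
   that the points x_1 < ... < x_k of PP carry the marks m_1, ..., m_k is the
   product of the Pois (lam x_i) [set m_i] (and 0 if PP does not have exactly
   k points). *)
Definition cond_independent_poisson_marks (lam : R -> R) PP N : Prop :=
  forall m : seq nat,
    measurable [set w | marks PP N w = m] /\
    forall G : set Omega, sigma_process PP G ->
      P (G `&` [set w | marks PP N w = m]) =
      (\int[P]_(w in G `&` [set w | size (PP w) = size m])
         \prod_(z <- zip (sorted_points PP w) m) Pois (lam z.1) [set z.2])%E.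

Definition total_mark PP N (w : Omega) : nat :=
  (\sum_(x <- PP w) N w x)%N.

End point_process.

(* Convergence of the distribution functions at every continuity point of the
   limiting one.  The X n need only be random variables for large n. *)
Definition cvg_in_distribution (R : realType) (d : nat -> measure_display)
    (Omega : forall n, measurableType (d n))
    (P : forall n, probability (Omega n) R) (X : forall n, Omega n -> R)
    (d' : measure_display) (Omega' : measurableType d')
    (P' : probability Omega' R) (Y : Omega' -> R) : Prop :=
  [/\ \forall n \near \oo, measurable_fun setT (X n),
      measurable_fun setT Y
    & forall t : R,
        {for t, continuous (fun u : R => P' [set w | Y w <= u])} ->
        P n [set w | X n w <= t] @[n --> \oo] --> P' [set w | Y w <= t]].

(* Main.v *)
Require Import Defs.
From mathcomp Require Import measurable_realfun ring lra zify.

(** We compare probability generating functions.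

    On the side of the colouring, the j-th binomial moment of the number of
    colourful progressions is a sum over sets S of j progressions.  If the
    members of S meet at most in common rare points, then S is colourful with
    probability n^-(j + number of rare points of S); this is also the weight of
    S in an idealised model with independent rare points in which the
    progressions through a rare point are coloured independently.  Adding
    progressions to S one at a time, each one costs a bounded factor, and a pair
    meeting in any other way costs a factor n^-delta, where delta is the least
    exponent in the palette: the other sets S are negligible in both models.
    The generating function of the idealised model is an explicit product, close
    to exp (1/n * sum_(i < n) (exp (u * lambda (i / n)) - 1)), and the
    alternation of the truncated binomial expansions of (1 + u)^X for
    -1 <= u <= 0 transfers this to the colouring.

    On the Poisson side, conditioning on the points turns the generating
    function at 1 + u into the expectation of the product of the
    exp (u * lambda x) over the points x; cutting [0, 1] into n cells shows
    that this is the limit of the same expressions. *)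

Set Implicit Arguments.
Unset Strict Implicit.
Unset Printing Implicit Defensive.

Local Open Scope ring_scope.

(** * Independent colourings *)

(** The upper tail of the number of colourful progressions is never bounded directly. The truncation
    error at order J is at most the J-th binomial moment, which lies within a constant times
    n^-delta of the moment of the idealised model; and the generating function of that model at the
    point 4 is bounded uniformly in n, whence an error of order 4^-J. The constant in front of
    n^-delta depends on J, so J is fixed before n.

    The idealised weight is given to every set S, clashing or not, because only the full sum over S
    factors over the possible rare points. It never exceeds the weight of the union of the colour
    constraints, so one bound on clashing sets serves both models.

    Behind the bounded factors is a balance: about n^2 progressions of weight n^-2, of order n
    through a given point, boundedly many through two. Deleting one coordinate of the palette leaves
    a weight of at most n^-1, since theta_max = 1; as r >= 3, only the deletion of the rare
    coordinate avoids a further factor n^-delta. *)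

Section product_mass.
Context (R : realFieldType) (I C : finType) (p : C -> R).
Hypotheses (p_ge0 : forall b, 0 <= p b) (p_sum1 : \sum_b p b = 1).

Definition product_mass (f : {ffun I -> C}) : R := \prod_i p (f i).

(** [U] is a set of demands (position, colour). Equal demands of several progressions merge into one
    pair, while contradictory demands remain as two pairs over one position. *)
Definition extends (U : {set I * C}) (f : {ffun I -> C}) : bool :=
  [forall x in U, f x.1 == x.2].

Definition pair_weight (U : {set I * C}) : R := \prod_(x in U) p x.2.

Lemma product_mass_ge0 f : 0 <= product_mass f.
Proof. by apply: prodr_ge0. Qed.

(** The colourings that extend [U] form a product set: the colour at [i] only has to agree with the
    pairs over [i]. *)
Lemma mass_extends U :
  \sum_(f | extends U f) product_mass f =
  \prod_i \sum_(b | [forall x in U, (x.1 == i) ==> (x.2 == b)]) p b.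
Proof.
rewrite bigA_distr_big_dep /=; apply: eq_bigl => f.
apply/forall_inP/familyP => [Uf i|Uf x xU].
  apply/forall_inP => x /Uf/eqP fx; apply/implyP => /eqP <-.
  by rewrite fx.
have /forall_inP/(_ x xU) := Uf x.1.
by rewrite eqxx eq_sym.
Qed.

Lemma pair_weight_fst U :
  pair_weight U = \prod_i \prod_(x in U | x.1 == i) p x.2.
Proof. by rewrite /pair_weight (partition_big fst xpredT). Qed.

(** Without a pair over [i] both sides are 1, with a single pair both are the probability of its
    colour, and with contradictory pairs the left side is an empty sum. *)
Lemma sum_fibre_le (U : {set I * C}) i :
  \sum_(b | [forall x in U, (x.1 == i) ==> (x.2 == b)]) p b <=
  \prod_(x in U | x.1 == i) p x.2.
Proof.
have [/existsP[[i' b] /= /andP[xU /eqP ii]]|/existsPn no] :=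
  boolP [exists x, (x \in U) && (x.1 == i)]; last first.
  rewrite [leRHS]big1 => [|x xU]; last by have := no x; rewrite xU.
  rewrite -p_sum1 (eq_bigl xpredT)// => b.
  by apply/forall_inP => x xU; have := no x; rewrite xU/= => /negbTE ->.
subst i'.
have [/existsP[[i' b'] /= /and3P[x'U /eqP ii bb]]|/existsPn yes] :=
  boolP [exists x, [&& x \in U, x.1 == i & x.2 != b]].
  rewrite big_pred0 ?prodr_ge0// => b2; apply/negbTE/negP => /forall_inP h.
  have := h _ xU; rewrite eqxx /= => /eqP bb2; subst b2.
  by have := h _ x'U; rewrite ii eqxx/= (negbTE bb).
rewrite (big_pred1 b) => [|b2 /=]; last first.
  apply/forall_inP/eqP => [/(_ _ xU)|->] /=.
    by rewrite eqxx => /eqP.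
  move=> x x'U; apply/implyP => xi.
  by have := yes x; rewrite x'U xi /= negbK.
rewrite (big_pred1 (i, b)) => [//|[i' b'] /=].
apply/andP/eqP => [[yU /eqP yi]|[-> ->]]; last by split.
by have := yes (i', b'); rewrite yU yi eqxx/= negbK => /eqP ->.
Qed.

Lemma mass_extends_le (U : {set I * C}) :
  \sum_(f | extends U f) product_mass f <= pair_weight U.
Proof.
rewrite mass_extends pair_weight_fst; apply: ler_prod => i _.
by rewrite sum_fibre_le sumr_ge0.
Qed.

Lemma mass_extends_eq (U : {set I * C}) : {in U &, injective fst} ->
  \sum_(f | extends U f) product_mass f = pair_weight U.
Proof.
move=> inj; rewrite mass_extends pair_weight_fst; apply: eq_bigr => i _.
have [/existsP[[i' b] /= /andP[xU /eqP ii]]|/existsPn no] :=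
  boolP [exists x, (x \in U) && (x.1 == i)]; last first.
  rewrite [RHS]big1 => [|x xU]; last by have := no x; rewrite xU.
  rewrite -p_sum1 (eq_bigl xpredT)// => b.
  by apply/forall_inP => x xU; have := no x; rewrite xU/= => /negbTE ->.
subst i'.
have fib x : (x \in U) && (x.1 == i) = (x == (i, b)).
  by apply/andP/eqP => [[x'U /eqP xi]|->//]; apply: inj.
rewrite (big_pred1 (i, b))//= (big_pred1 b) => [//|b2 /=].
apply/forall_inP/eqP => [/(_ _ xU)|-> x x'U]; first by rewrite eqxx => /eqP.
by apply/implyP => xi; have := fib x; rewrite x'U xi => /esym/eqP ->.
Qed.

End product_mass.

(** * Generating functions over families of subsets *)

Section subset_sums.
Context (R : comNzRingType) (T I : finType).

Lemma sum_subsets (A : {set T}) (v : R) :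
  \sum_(S : {set T} | S \subset A) v ^+ #|S| = (1 + v) ^+ #|A|.
Proof.
have -> : (1 + v) ^+ #|A| = \prod_t ((if t \in A then v else 0) + 1).
  rewrite (bigID (mem A))/= [X in _ * X]big1 ?mulr1 => [|t /negbTE ->]; last first.
    by rewrite add0r.
  by rewrite (eq_bigr (fun=> 1 + v)) ?prodr_const// => t ->; rewrite addrC.
rewrite bigA_distr [RHS](bigID (fun S : {set T} => S \subset A))/=.
rewrite [X in _ + X]big1 ?addr0 => [|S /subsetPn[t tS tA]]; last first.
  by rewrite (bigD1 t)//= tS (negbTE tA) mul0r.
apply: eq_bigr => S /fintype.subsetP SA.
rewrite (bigID (mem S))/= [X in _ * X]big1 ?mulr1 => [|t /negbTE ->//].
by rewrite (eq_bigr (fun=> v)) ?prodr_const// => t tS; rewrite tS SA.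
Qed.

Lemma sum_supersets (J : {set I}) (rho : R) :
  \sum_(K : {set I} | J \subset K) \prod_i (if i \in K then rho else 1 - rho) =
  rho ^+ #|J|.
Proof.
have -> : rho ^+ #|J| = \prod_i (rho + (if i \in J then 0 else 1 - rho)).
  rewrite (bigID (mem J))/= [X in _ * X]big1 ?mulr1 => [|t /negbTE ->]; last first.
    by rewrite subrKC.
  by rewrite (eq_bigr (fun=> rho)) ?prodr_const// => t ->; rewrite addr0.
rewrite bigA_distr [RHS](bigID (fun K : {set I} => J \subset K))/=.
rewrite [X in _ = _ + X]big1 ?addr0 => [|K /subsetPn[t tS tA]]; last first.
  by rewrite (bigD1 t)//= tS (negbTE tA) mul0r.
apply: eq_bigr => K /fintype.subsetP JK; apply: eq_bigr => i _.
by case: ifPn => // iK; case: ifPn => // /JK; rewrite (negbTE iK).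
Qed.

(* Expand [rho ^+ #|g @: S|] over the supersets K of [g @: S]: K plays the
   role of a random set containing each point with probability rho. *)
Lemma sum_subsets_image (A : {set T}) (g : T -> I) (v rho : R) :
  \sum_(S : {set T} | S \subset A) v ^+ #|S| * rho ^+ #|(g @: S)%SET| =
  \prod_i (rho * (1 + v) ^+ #|[set t in A | g t == i]%SET| + (1 - rho)).
Proof.
under [LHS]eq_bigr => S _ do rewrite -(sum_supersets (g @: S)%SET) mulr_sumr.
rewrite (exchange_big_dep xpredT)//= bigA_distr; apply: eq_bigr => K _.
rewrite -mulr_suml.
have -> : \sum_(S : {set T} | (S \subset A) && ((g @: S)%SET \subset K)) v ^+ #|S|
   = \prod_(i in K) (1 + v) ^+ #|[set t in A | g t == i]%SET|.
  (* For fixed K, the admissible S are the subsets of the part of A that [g] maps into K, and this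
     part splits into the fibres over K. *)
  rewrite (eq_bigl (fun S : {set T} => S \subset [set t in A | g t \in K]%SET)).
    rewrite sum_subsets prodrXr; congr (_ ^+ _).
    rewrite -sum1_card (partition_big g (mem K)) => [|t]/=; last first.
      by rewrite inE => /andP[].
    apply: eq_bigr => i iK; rewrite -sum1_card; apply: eq_bigl => t.
    by rewrite !inE -andbA; congr (_ && _); case: eqP => [->|]; rewrite ?andbF ?iK.
  move=> S; rewrite !finset.setIdE finset.subsetI; congr (_ && _).
  apply/fintype.subsetP/fintype.subsetP => [h t tS|h _ /imsetP[t tS ->]].
    by rewrite inE h// imset_f.
  by have := h _ tS; rewrite inE.
rewrite [X in _ * X = _](bigID (mem K))/= [in RHS](bigID (mem K))/= mulrA; congr (_ * _).
  rewrite -big_split/=; apply: eq_bigr => i iK.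
  by rewrite iK mulrC.
by apply: eq_bigr => i /negbTE ->.
Qed.

End subset_sums.

(** * Counting arithmetic progressions *)

Lemma card_bigcup_le (I T : finType) (P : pred I) (F : I -> {set T}) :
  (#|\bigcup_(i | P i) F i| <= \sum_(i | P i) #|F i|)%N.
Proof.
elim/big_rec2: _ => [|i m A _ Am]; first by rewrite cards0.
by rewrite (leq_trans (leq_card_setU _ _).1) ?leq_add2l.
Qed.

Section APs.
Variables (n r : nat).
Implicit Types t : {ffun 'I_r -> 'I_n}.

(** Locked so that [inE] leaves membership in [APs] folded instead of exposing the classical
    predicate. *)
Definition APs : {set {ffun 'I_r -> 'I_n}} :=
  locked [set t | `[< is_AP t >]]%SET.

Lemma APsP t : reflect (is_AP t) (t \in APs).
Proof. by rewrite /APs -lock finset.in_set; apply: asboolP. Qed.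

Lemma AP_inj t : t \in APs -> injective t.
Proof.
move=> /APsP[x [d [d0 td]]] s s' /(congr1 val)/=.
rewrite !td => /addnI/eqP; rewrite eqn_pmul2r// => /eqP.
exact: val_inj.
Qed.

Lemma AP_eq2 t t' (s s' : 'I_r) : t \in APs -> t' \in APs -> s != s' ->
  t s = t' s -> t s' = t' s' -> t = t'.
Proof.
move=> /APsP[x [d [d0 td]]] /APsP[x' [d' [d0' td']]] ss'.
move=> /(congr1 val)/= + /(congr1 val)/=; rewrite !td !td' => h h'.
have ss : (s != s' :> nat) by [].
have dd : d = d' by nia.
subst d'; have xx : x = x' by lia.
by subst x'; apply/ffunP => k; apply: val_inj; rewrite /= td td'.
Qed.

(** The step of [t'] is a positive multiple of that of [t], while the span of [t'] is at most that
    of [t]; so the steps agree, and then the starting points do. *)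
Lemma AP_subset_eq t t' : (2 <= r)%N -> t \in APs -> t' \in APs ->
  (forall s, exists s', t' s = t s') -> t' = t.
Proof.
move=> r2 /APsP[x [d [d0 td]]] /APsP[x' [d' [d0' td']]] sub.
have r0 : (0 < r)%N by lia.
have r1 : (r.-1 < r)%N by lia.
have [g0 /(congr1 val)/=] := sub (Ordinal r0); rewrite td td'/= => h0.
have [g1 /(congr1 val)/=] := sub (Ordinal r2); rewrite td td'/= => h1.
have [g2 /(congr1 val)/=] := sub (Ordinal r1); rewrite td td'/= => h2.
have g2r := ltn_ord g2.
have gg : (g0 < g1)%N by nia.
have dd : (d <= d')%N by nia.
have g2r' : (g2 <= r.-1)%N by lia.
have h3 : (g2 * d <= r.-1 * d)%N by rewrite leq_mul2r g2r' orbT.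
have h4 : (r.-1 * d <= r.-1 * d')%N by rewrite leq_mul2l dd orbT.
have h5 : (r.-1 * d = r.-1 * d')%N by nia.
have d'd : d' = d by nia.
subst d'; have xx : x' = x by nia.
by subst x'; apply/ffunP => k; apply: val_inj; rewrite /= td td'.
Qed.

Lemma card_APs : (2 <= r)%N -> (#|APs| <= n ^ 2)%N.
Proof.
move=> r2; have r0 : (0 < r)%N by lia.
pose g t := (t (Ordinal r0), t (Ordinal r2)).
have gi : {in APs &, injective g}.
  by move=> t t' tA t'A [h0 h1]; apply: (AP_eq2 tA t'A _ h0 h1).
rewrite -(card_in_imset gi) (leq_trans (max_card _))//.
by rewrite card_prod card_ord mulnn.
Qed.

Lemma card_APs_at (s : 'I_r) (v : 'I_n) : (2 <= r)%N ->
  (#|[set t in APs | t s == v]%SET| <= n)%N.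
Proof.
move=> r2; have [s' ss'] : exists s' : 'I_r, s != s'.
  have r0 : (0 < r)%N by lia.
  have [->|] := eqVneq s (Ordinal r0); last by exists (Ordinal r0).
  by exists (Ordinal r2).
have gi : {in [set t in APs | t s == v]%SET &, injective (fun t => t s')}.
  move=> t t'; rewrite !inE.
  move=> /andP[tA /eqP ts] /andP[t'A /eqP t's] h.
  by apply: (AP_eq2 tA t'A ss') => //; rewrite ts t's.
by rewrite -(card_in_imset gi) (leq_trans (max_card _))// card_ord.
Qed.

Lemma card_APs_at2 (s s' : 'I_r) (v v' : 'I_n) : s != s' ->
  (#|[set t in APs | (t s == v) && (t s' == v')]%SET| <= 1)%N.
Proof.
move=> ss'; apply/card_le1_eqP => t t'; rewrite !inE.
move=> /and3P[tA /eqP ts /eqP ts'] /and3P[t'A /eqP t's /eqP t's'].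
by apply: (AP_eq2 _ _ ss'); rewrite ?inE// ?ts ?ts' ?t's ?t's'.
Qed.

Definition hits (V : {set 'I_n}) t : {set 'I_r} := [set s | t s \in V]%SET.

Lemma card_hits_ge1 (V : {set 'I_n}) : (2 <= r)%N ->
  (#|[set t in APs | (0 < #|hits V t|)%N]%SET| <= r * #|V| * n)%N.
Proof.
move=> r2.
have sub : [set t in APs | (0 < #|hits V t|)%N]%SET \subset
    \bigcup_(z in finset.setX [set: 'I_r] V) [set t in APs | t z.1 == z.2]%SET.
  apply/fintype.subsetP => t; rewrite !inE => /andP[tA].
  rewrite card_gt0 => /set0Pn[s]; rewrite inE => sV.
  apply/bigcupP; exists (s, t s); first by rewrite !inE.
  by rewrite !inE tA/=.
apply: leq_trans (subset_leq_card sub) _.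
apply: leq_trans (card_bigcup_le _ _) _.
have -> : (r * #|V| * n = \sum_(z in finset.setX [set: 'I_r] V) n)%N.
  by rewrite sum_nat_const cardsX finset.cardsT card_ord.
by apply: leq_sum => z _; exact: card_APs_at.
Qed.

Lemma card_hits_ge2 (V : {set 'I_n}) : (2 <= r)%N ->
  (#|[set t in APs | (1 < #|hits V t|)%N]%SET| <= (r * #|V|) ^ 2)%N.
Proof.
move=> r2.
pose Z := [set z in finset.setX (finset.setX [set: 'I_r] V) (finset.setX [set: 'I_r] V) |
  z.1.1 != z.2.1]%SET.
have sub : [set t in APs | (1 < #|hits V t|)%N]%SET \subset
    \bigcup_(z in Z)
    [set t in APs | (t z.1.1 == z.1.2) && (t z.2.1 == z.2.2)]%SET.
  apply/fintype.subsetP => t; rewrite !inE => /andP[tA] /card_gt1P[s [s' []]]; rewrite !inE => sV s'V ss'.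
  apply/bigcupP; exists ((s, t s), (s', t s')); first by rewrite !inE/= sV s'V.
  by rewrite !inE tA/= !eqxx.
apply: leq_trans (subset_leq_card sub) _.
apply: leq_trans (card_bigcup_le _ _) _.
apply: (@leq_trans (\sum_(z in Z) 1)%N).
  by apply: leq_sum => z; rewrite inE => /andP[_]; exact: card_APs_at2.
rewrite sum1_card; apply: (@leq_trans #|finset.setX (finset.setX [set: 'I_r] V) (finset.setX [set: 'I_r] V)|).
  by apply/subset_leq_card/fintype.subsetP => z; rewrite inE => /andP[].
by rewrite !cardsX finset.cardsT card_ord mulnn.
Qed.

(** For bounded V the three counts have orders n^2, n and 1. They are to be paired with weights of
    orders n^-2, n^-1 and 1. *)
Lemma sum_APs_le (R : realDomainType) (V : {set 'I_n})
    (w : {ffun 'I_r -> 'I_n} -> R) (x0 x1 x2 : R) : (2 <= r)%N ->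
  0 <= x0 -> 0 <= x1 -> 0 <= x2 ->
  (forall t, t \in APs -> #|hits V t| = 0%N -> w t <= x0) ->
  (forall t, t \in APs -> #|hits V t| = 1%N -> w t <= x1) ->
  (forall t, t \in APs -> (1 < #|hits V t|)%N -> w t <= x2) ->
  \sum_(t in APs) w t <=
    (n ^ 2)%:R * x0 + (r * #|V| * n)%:R * x1 + ((r * #|V|) ^ 2)%:R * x2.
Proof.
move=> r2 x00 x10 x20 w0 w1 w2.
have step (P : pred nat) (m : nat) (x : R) : 0 <= x ->
    (#|[set t in APs | P #|hits V t|]%SET| <= m)%N ->
    \sum_(t in APs) (if P #|hits V t| then x else 0) <= m%:R * x.
  move=> x_ge0 cm; rewrite -big_mkcondr/= sumr_const -[leLHS]mulr_natl.
  apply: ler_wpM2r => //; rewrite ler_nat (leq_trans _ cm)// eq_leq//.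
  by apply: eq_card => t; rewrite !inE.
apply: (@le_trans _ _ (\sum_(t in APs) (x0 +
   (if (0 < #|hits V t|)%N then x1 else 0) +
   (if (1 < #|hits V t|)%N then x2 else 0)))).
  apply: ler_sum => t tA; case E : #|hits V t| => [|[|k]]/=.
  - by rewrite !addr0 w0.
  - by rewrite addr0 (le_trans (w1 _ tA E))// lerDr.
  - by rewrite (le_trans (w2 _ tA _)) ?E// lerDr addr_ge0.
rewrite !big_split/= !lerD//.
- rewrite sumr_const -[leLHS]mulr_natl ler_wpM2r// ler_nat; exact: card_APs.
- exact: (step (fun k => 0 < k)%N) (card_hits_ge1 _ r2).
- exact: (step (fun k => 1 < k)%N) (card_hits_ge2 _ r2).
Qed.

End APs.

(** * Clusters of progressions *)

(** A product over members differs from a product over their union only by multiplicities; this is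
    how the idealised weight is compared with the true one. *)
Lemma prod_bigcup_mult (R : comNzRingType) (T X : finType) (S : {set T})
    (F : T -> {set X}) (g : X -> R) :
  \prod_(t in S) \prod_(x in F t) g x =
  \prod_(x in \bigcup_(t in S) F t) g x ^+ #|[set t in S | x \in F t]%SET|.
Proof.
rewrite (exchange_big_dep (mem (\bigcup_(t in S) F t)))/= => [|t x tS xF]; last first.
  by apply/bigcupP; exists t.
apply: eq_bigr => x _; rewrite -[RHS]prodr_const; apply: eq_bigl => t.
by rewrite inE.
Qed.

Lemma prod_le_sub (R : numDomainType) (I : finType) (P Q : pred I) (q : I -> R) :
  (forall i, 0 <= q i <= 1) -> (forall i, P i -> Q i) ->
  \prod_(i | Q i) q i <= \prod_(i | P i) q i.
Proof.
move=> q01 PQ; rewrite (bigID P)/= (eq_bigl P) => [|i]; last first.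
  by case Pi : (P i); rewrite ?andbF// PQ.
apply: ler_piMr; first by apply: prodr_ge0 => i _; have /andP[] := q01 i.
by apply: prodr_ile1 => i _.
Qed.

Section weights.
Variables (R : realFieldType) (n r : nat) (C : finType).
Variables (p : C -> R) (a : 'I_r -> C).
Implicit Types (t : {ffun 'I_r -> 'I_n}) (S : {set {ffun 'I_r -> 'I_n}}).
Implicit Types U : {set 'I_n * C}.

Definition AP_graph t : {set 'I_n * C} := [set (t s, a s) | s : 'I_r]%SET.

Definition graphs S : {set 'I_n * C} := (\bigcup_(t in S) AP_graph t)%SET.

(** This is the probability that all members of S are colourful unless two of them demand different
    colours at one point; then that probability is 0 and the weight merely bounds it. *)
Definition weight S : R := pair_weight p (graphs S).

Definition fresh_weight U t : R := \prod_(s | (t s, a s) \notin U) p (a s).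

Lemma graphsU1 t S : graphs (t |: S)%SET = (AP_graph t :|: graphs S)%SET.
Proof. by rewrite /graphs finset.bigcup_setU finset.big_set1. Qed.

Lemma card_graphs S : (#|graphs S| <= r * #|S|)%N.
Proof.
rewrite (leq_trans (card_bigcup_le _ _))// mulnC -sum_nat_const.
apply: leq_sum => t _; rewrite (leq_trans (leq_imset_card _ _))//.
by rewrite card_ord.
Qed.

(** The terms of a progression are distinct, so different coordinates give different new pairs and
    each new pair is paid for once. *)
Lemma pair_weight_graph U t : t \in APs n r ->
  pair_weight p (AP_graph t :|: U)%SET = fresh_weight U t * pair_weight p U.
Proof.
move=> tA; rewrite /pair_weight (bigID (mem U))/= mulrC; congr (_ * _).
  have -> : \prod_(i in AP_graph t :|: U | i \notin U) p i.2 =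
      \prod_(i in [set (t s, a s) | s in [pred s | (t s, a s) \notin U]]%SET) p i.2.
    apply: eq_bigl => x; rewrite !inE.
    apply/andP/imsetP => [[/orP[/imsetP[s _ ->] xU|->//]]|[s]].
      by exists s.
    by rewrite inE => sU ->; rewrite sU imset_f.
  by rewrite big_imset//= => s s' _ _ [/(AP_inj tA)].
by apply: eq_bigl => x; rewrite inE orbC; case: (x \in U); rewrite ?andbF.
Qed.

Hypotheses (n_gt0 : (0 < n)%N) (r_ge3 : (3 <= r)%N).
Variables (eps : R) (rare : 'I_r).
Let N : R := n%:R.
Hypotheses (p_ge0 : forall b, 0 <= p b) (pa_eps : forall s, p (a s) <= eps).
Hypotheses (eps_le1 : eps <= 1) (prod_pa : \prod_s p (a s) = N ^- 2).
Hypotheses (pa_rare : p (a rare) = N^-1).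
Hypotheses (a_rare : forall s, s != rare -> a s != a rare).

Let N_gt0 : 0 < N. Proof. by rewrite ltr0n. Qed.
Let N_neq0 : N != 0. Proof. by rewrite gt_eqF. Qed.
Let Nv_ge0 : 0 <= N^-1. Proof. by rewrite invr_ge0 ler0n. Qed.
Let r_ge2 : (2 <= r)%N. Proof. exact: ltnW. Qed.
Let Nn : N ^+ 2 = (n ^ 2)%:R. Proof. by rewrite natrX. Qed.

Let q01 s : 0 <= p (a s) <= 1.
Proof. by rewrite p_ge0 (le_trans (pa_eps s)). Qed.

Let eps_ge0 : 0 <= eps. Proof. exact: le_trans (pa_eps rare). Qed.

Lemma prod_pa_notrare : \prod_(s | s != rare) p (a s) = N^-1.
Proof.
move: prod_pa; rewrite (bigD1 rare)//= pa_rare => /(congr1 (fun x => N * x)).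
by rewrite mulrA divff// mul1r => ->; field.
Qed.

(** Since [3 <= r], besides the rare coordinate, which gives [N^-1], at least one other coordinate
    remains and gives [eps]. *)
Lemma prod_pa_but_one (s0 : 'I_r) : s0 != rare ->
  \prod_(s | s != s0) p (a s) <= N^-1 * eps.
Proof.
move=> s0r; have [s1 s10 s1r] : exists2 s1 : 'I_r, s1 != s0 & s1 != rare.
  have : (0 < #|[set~ s0] :\ rare|)%SET%N.
    have := cardsC1 s0; rewrite card_ord (cardsD1 rare) !inE eq_sym s0r.
    by lia.
  by rewrite card_gt0 => /set0Pn[s1]; rewrite !inE => /andP[? ?]; exists s1.
apply: le_trans (@prod_le_sub _ _ (fun s => (s == rare) || (s == s1)) _ _ q01 _) _.
  by move=> s /orP[] /eqP ->//; rewrite eq_sym.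
rewrite (bigD1 rare) ?eqxx//= pa_rare ler_wpM2l ?Nv_ge0//.
rewrite (big_pred1 s1) ?pa_eps// => s /=.
by have [->|] := eqVneq s rare; rewrite ?andbT// eq_sym (negbTE s1r).
Qed.

Lemma prod_pa_le : N ^- 2 <= N^-1 * eps.
Proof.
have [s0 s0r] : exists s0 : 'I_r, s0 != rare.
  have : (0 < #|[set~ rare]|)%SET%N by rewrite cardsC1 card_ord; lia.
  by rewrite card_gt0 => /set0Pn[s1]; rewrite !inE; exists s1.
by rewrite -prod_pa (le_trans _ (prod_pa_but_one s0r))// prod_le_sub.
Qed.

Lemma fresh_weight_hits U t :
  fresh_weight U t <= \prod_(s | s \notin hits (fst @: U)%SET t) p (a s).
Proof.
apply: prod_le_sub => // s; rewrite inE; apply: contra => tU.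
by apply/imsetP; exists (t s, a s).
Qed.

Lemma fresh_weight_le1 U t : fresh_weight U t <= 1.
Proof. by apply: prodr_ile1 => s _. Qed.

Lemma fresh_weight_hits0 U t :
  #|hits (fst @: U)%SET t| = 0%N -> fresh_weight U t <= N ^- 2.
Proof.
move=> /eqP; rewrite cards_eq0 => /eqP h0.
rewrite (le_trans (fresh_weight_hits _ _))// h0 -prod_pa.
by under eq_bigl do rewrite inE.
Qed.

Lemma fresh_weight_hits1 U t s0 :
  hits (fst @: U)%SET t = [set s0]%SET ->
  fresh_weight U t <= \prod_(s | s != s0) p (a s).
Proof.
move=> h1; rewrite (le_trans (fresh_weight_hits _ _))// h1.
by under eq_bigl do rewrite inE.
Qed.

(** The terms account for new progressions that meet m given ones in no, one or several coordinates;
    [r * m] bounds the number of points covered. *)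
Definition ext_cst (m : nat) : R := 1 + (r * (r * m))%:R + ((r * (r * m)) ^ 2)%:R.

Lemma ext_cst_ge0 m : 0 <= ext_cst m.
Proof. by rewrite /ext_cst !addr_ge0. Qed.

Lemma card_fst_graphs S : (#|fst @: graphs S|%SET <= r * #|S|)%N.
Proof. by rewrite (leq_trans (leq_imset_card _ _))// card_graphs. Qed.

Lemma weight_ge0 S : 0 <= weight S.
Proof. by apply: prodr_ge0. Qed.

(** The counts balance the new factors: n^2 times [N ^- 2], n times [N^-1], and boundedly many times
    1. In the middle case one coordinate is already paid for, and the others multiply to at most
    [N^-1]. *)
Lemma sum_weight_ext S :
  \sum_(t in APs n r) weight (t |: S)%SET <= ext_cst #|S| * weight S.
Proof.
under eq_bigr => t tA do rewrite /weight graphsU1 pair_weight_graph//.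
rewrite -mulr_suml ler_wpM2r ?weight_ge0//.
apply: (@le_trans _ _ ((n ^ 2)%:R * N ^- 2 +
    (r * #|fst @: graphs S|%SET * n)%:R * N^-1 +
    ((r * #|fst @: graphs S|%SET) ^ 2)%:R * 1)).
  apply: sum_APs_le => //; rewrite ?invr_ge0 ?exprn_ge0 ?ler0n//.
  - by move=> t _; exact: fresh_weight_hits0.
  - move=> t _ /eqP/cards1P[s0 h1].
    rewrite (le_trans (fresh_weight_hits1 h1))//.
    have [->|s0r] := eqVneq s0 rare; first by rewrite prod_pa_notrare.
    by rewrite (le_trans (prod_pa_but_one s0r))// ler_piMr ?Nv_ge0.
  - by move=> t _ _; exact: fresh_weight_le1.
have Vr := card_fst_graphs S.
rewrite /ext_cst natrX -/N divff ?expf_neq0// natrM -/N mulfK// mulr1.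
by rewrite !lerD// ler_nat ?leq_exp2r// leq_mul2l Vr orbT.
Qed.

Fixpoint ext_cst_iter (m k : nat) : R :=
  if k is k'.+1 then ext_cst_iter m k' * ext_cst (m + k') else 1.

Lemma ext_cst_iter_ge0 m k : 0 <= ext_cst_iter m k.
Proof. by elim: k => //= k IH; rewrite mulr_ge0// ext_cst_ge0. Qed.

(** By induction on k: a larger set is recovered from one chosen member outside [S0] and the set
    without it, so its weight occurs in the double sum over a smaller set and a progression to
    add. *)
Lemma sum_weight_supersets S0 k :
  \sum_(S : {set {ffun 'I_r -> 'I_n}} |
     [&& S \subset APs n r, S0 \subset S & #|S| == (#|S0| + k)%N]) weight S
  <= ext_cst_iter #|S0| k * weight S0.
Proof.
elim: k => [|k IH].
  rewrite mul1r; have [S0A|S0A] := boolP (S0 \subset APs n r); last first.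
    rewrite big_pred0 ?weight_ge0// => S; apply/negbTE; apply: contra S0A.
    by move=> /and3P[SA S0S _]; exact: fintype.subset_trans SA.
  rewrite (big_pred1 S0)// => S; rewrite /= addn0.
  apply/and3P/eqP => [[_ S0S /eqP SS0]|->]; last by rewrite S0A fintype.subxx eqxx.
  by apply/esym/eqP; rewrite eqEcard S0S SS0/=.
pose A m := [set S : {set {ffun 'I_r -> 'I_n}} |
     [&& S \subset APs n r, S0 \subset S & #|S| == (#|S0| + m)%N]]%SET.
have AE m : \sum_(S : {set {ffun 'I_r -> 'I_n}} |
     [&& S \subset APs n r, S0 \subset S & #|S| == (#|S0| + m)%N]) weight S =
    \sum_(S in A m) weight S by apply: eq_bigl => S; rewrite inE.
have [A0|/set0Pn[S1 S1A]] := eqVneq (A k.+1) finset.set0.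
  by rewrite AE A0 big_set0 mulr_ge0 ?weight_ge0//= mulr_ge0 ?ext_cst_ge0 ?ext_cst_iter_ge0.
have [t0 _] : exists t0, t0 \in (S1 :\: S0)%SET.
  apply/set0Pn; rewrite -card_gt0; move: S1A; rewrite inE => /and3P[_ S0S /eqP cS].
  by rewrite cardsDS// cS addKn.
(* [t0] is only a default value, never taken on [A k.+1]. *)
pose pt S := odflt t0 [pick t in (S :\: S0)%SET].
have ptP S : S \in A k.+1 -> pt S \in (S :\: S0)%SET.
  rewrite inE /pt => /and3P[_ S0S /eqP cS]; case: pickP => [t //|no].
  have : (0 < #|S :\: S0|)%SET%N by rewrite cardsDS// cS addKn.
  by rewrite card_gt0 => /set0Pn[t]; rewrite no.
pose g S := ((S :\ pt S)%SET, pt S).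
pose F (z : {set {ffun 'I_r -> 'I_n}} * {ffun 'I_r -> 'I_n}) := weight (z.2 |: z.1)%SET.
have gK S : S \in A k.+1 -> ((g S).2 |: (g S).1)%SET = S.
  by move=> /ptP; rewrite inE => /andP[_ ptS]; rewrite /g/= finset.setD1K.
have gi : {in A k.+1 &, injective g}.
  by move=> S S' SA S'A gg; rewrite -(gK _ SA) -(gK _ S'A) gg.
rewrite AE.
have -> : \sum_(S in A k.+1) weight S = \sum_(z in (g @: A k.+1)%SET) F z.
  by rewrite big_imset//=; apply: eq_bigr => S SA; rewrite /F gK.
apply: (@le_trans _ _ (\sum_(S in A k) \sum_(t in APs n r) weight (t |: S)%SET)).
  rewrite pair_big_dep/= big_mkcond [leRHS]big_mkcond/=; apply: ler_sum => z _.
  case: ifPn => [/imsetP[S SA ->]|_]; last by case: ifP => // _; exact: weight_ge0.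
  have := ptP _ SA; rewrite inE => /andP[ptS0 ptS].
  move: (SA); rewrite inE => /and3P[SAP S0S /eqP cS].
  rewrite /g /= (fintype.subsetP SAP)// andbT inE.
  rewrite (fintype.subset_trans (subsetDl _ _) SAP)/=.
  have -> : S0 \subset (S :\ pt S)%SET.
    apply/fintype.subsetP => t tS0; rewrite !inE (fintype.subsetP S0S)// andbT.
    by apply: contraNneq ptS0 => <-.
  by have := cardsD1 (pt S) S; rewrite ptS cS addnS add1n => -[<-]; rewrite eqxx.
apply: (@le_trans _ _ (\sum_(S in A k) ext_cst (#|S0| + k) * weight S)).
  apply: ler_sum => S; rewrite inE => /and3P[_ _ /eqP <-]; exact: sum_weight_ext.
rewrite -mulr_sumr -AE /= mulrAC mulrC ler_wpM2r//; exact: ext_cst_ge0.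
Qed.

(** Sharing the rare point is the one intersection that is allowed, since it is what creates the
    clusters of the limit. A progression clashes with itself, hence the conditions [t2 != t1]
    below. *)
Definition clash t1 t2 : bool :=
  [exists s, exists s', (t1 s == t2 s') && ((s, s') != (rare, rare))].

Definition clash_cst : R := (r * r)%:R + ((r * r) ^ 2)%:R.

Lemma weight1 t : t \in APs n r -> weight [set t]%SET = N ^- 2.
Proof.
move=> tA; rewrite /weight -[[set t]%SET]finset.setU0 graphsU1 /graphs finset.big_set0.
rewrite pair_weight_graph// /pair_weight finset.big_set0 mulr1 -prod_pa.
by apply: eq_bigl => s; rewrite inE.
Qed.

(** Compared with the extension by an arbitrary progression, the case without a common point
    disappears and each of the other two gains a factor [eps]. *)
Lemma sum_weight_clash1 t1 : t1 \in APs n r ->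
  \sum_(t2 in APs n r | (t2 != t1) && clash t1 t2) weight [set t2; t1]%SET <=
  clash_cst * eps * weight [set t1]%SET.
Proof.
move=> t1A.
under eq_bigr => t /andP[tA _] do rewrite /weight graphsU1 pair_weight_graph//.
rewrite -mulr_suml ler_wpM2r ?weight_ge0// big_mkcondr/=.
set U := graphs _.
have UE : U = AP_graph t1 by rewrite /U /graphs finset.big_set1.
have inU t2 s s' : t1 s = t2 s' -> s' \in hits (fst @: U)%SET t2.
  move=> tt; rewrite inE -tt; apply/imsetP; exists (t1 s, a s) => //.
  by rewrite UE; apply/imsetP; exists s.
apply: (@le_trans _ _ ((n ^ 2)%:R * 0 +
    (r * #|fst @: U|%SET * n)%:R * (N^-1 * eps) +
    ((r * #|fst @: U|%SET) ^ 2)%:R * eps)).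
  apply: sum_APs_le => //; rewrite ?mulr_ge0 ?Nv_ge0//.
  - move=> t2 t2A h0; case: ifPn => // /andP[_ /existsP[s /existsP[s']]].
    move=> /andP[/eqP/inU]; move/eqP: h0; rewrite cards_eq0 => /eqP ->.
    by rewrite inE.
  - move=> t2 t2A /eqP/cards1P[s0 h1]; case: ifPn; last first.
      by rewrite mulr_ge0.
    move=> /andP[_ /existsP[s /existsP[s' /andP[/eqP tt]]]].
    have := inU _ _ _ tt; rewrite h1 inE => /eqP ?; subst s'.
    have [s0r|s0r _] := eqVneq s0 rare; last first.
      by rewrite (le_trans (fresh_weight_hits1 h1))// prod_pa_but_one.
    (* The only common point is rare for [t2] but not for [t1], so the two demand different colours
       there. All pairs of [t2] are then new, with the full factor [N ^- 2]. *)
    subst s0; rewrite xpair_eqE eqxx andbT => sr.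
    rewrite (le_trans _ prod_pa_le)// -prod_pa prod_le_sub// => s' _.
    have [->|s'r] := eqVneq s' rare.
      rewrite UE; apply/negP => /imsetP[s2 _ [tt2 aa]].
      have [s2r|/a_rare] := eqVneq s2 rare; last by rewrite aa eqxx.
      subst s2; move: sr; rewrite -(inj_eq (AP_inj t1A)) tt -tt2.
      by rewrite eqxx.
    apply/negP => s'U; have : s' \in hits (fst @: U)%SET t2.
      by rewrite inE; apply/imsetP; exists (t2 s', a s').
    by rewrite h1 inE (negbTE s'r).
  - move=> t2 t2A _; case: ifPn => // /andP[t21 _].
    (* A single new pair gives [eps]; if there were none, every entry of [t2] would be an entry of
       [t1] and the two would coincide. *)
    have [/existsP[s sU]|/existsPn all] := boolP [exists s, (t2 s, a s) \notin U].
      rewrite (le_trans _ (pa_eps s))// /fresh_weight -[leRHS](big_pred1_eq *%R s (fun s => p (a s))).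
      by apply: prod_le_sub => // s' /eqP ->.
    case/negP: t21; apply/eqP; apply: (AP_subset_eq r_ge2 t1A t2A) => s.
    have := all s; rewrite negbK UE => /imsetP[s' _ [-> _]].
    by exists s'.
have Vr : (#|fst @: U|%SET <= r)%N.
  by have := card_fst_graphs [set t1]%SET; rewrite cards1 muln1.
rewrite mulr0 add0r /clash_cst mulrDl lerD//.
  rewrite natrM -/N mulrA mulfK// ler_wpM2r// ler_nat leq_mul2l Vr orbT//.
by rewrite ler_wpM2r// ler_nat leq_exp2r// leq_mul2l Vr orbT.
Qed.

Lemma clash_cst_ge0 : 0 <= clash_cst.
Proof. by rewrite addr_ge0. Qed.

Lemma sum_weight_clash :
  \sum_(t1 in APs n r) \sum_(t2 in APs n r | (t2 != t1) && clash t1 t2)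
    weight [set t2; t1]%SET <= clash_cst * eps.
Proof.
apply: (@le_trans _ _ (\sum_(t1 in APs n r) clash_cst * eps * N ^- 2)).
  by apply: ler_sum => t1 t1A; rewrite -(weight1 t1A) sum_weight_clash1.
rewrite sumr_const -[leLHS]mulr_natl mulrCA ler_piMr//.
  by rewrite mulr_ge0 ?clash_cst_ge0.
by rewrite ler_pdivrMr ?exprn_gt0// mul1r Nn ler_nat card_APs.
Qed.

Definition clashing S : bool :=
  [exists t1 in S, exists t2 in S, (t2 != t1) && clash t1 t2].

(** Union bound over a clashing pair, completed to a set of size j by [j - 2] further progressions.
    The truncated subtraction is harmless, a clashing set having at least two members. *)
Lemma sum_weight_clashing j :
  \sum_(S : {set {ffun 'I_r -> 'I_n}} |
     [&& S \subset APs n r, #|S| == j & clashing S]) weight S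
  <= ext_cst_iter 2 (j - 2) * clash_cst * eps.
Proof.
apply: (@le_trans _ _ (\sum_(t1 in APs n r)
   \sum_(t2 in APs n r | (t2 != t1) && clash t1 t2)
   \sum_(S : {set {ffun 'I_r -> 'I_n}} |
     [&& S \subset APs n r, [set t2; t1]%SET \subset S &
         #|S| == (#|[set t2; t1]%SET| + (j - 2))%N]) weight S)).
  rewrite pair_big_dep/= (exchange_big_dep xpredT)//= big_mkcond/=.
  apply: ler_sum => S _; case: ifPn => [|_]; last first.
    by apply: sumr_ge0 => z _; exact: weight_ge0.
  move=> /and3P[SA /eqP cS /exists_inP[t1 t1S /exists_inP[t2 t2S]]] cl.
  have t1A := fintype.subsetP SA _ t1S; have t2A := fintype.subsetP SA _ t2S.
  have sub : [set t2; t1]%SET \subset S.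
    by apply/fintype.subsetP => t; rewrite !inE => /orP[]/eqP ->.
  have c2 : #|[set t2; t1]%SET| = 2 by rewrite cards2; case/andP: cl => ->.
  have j2 : (2 <= j)%N by rewrite -cS; have := subset_leq_card sub; rewrite c2.
  rewrite (bigD1 (t1, t2))/=; last by rewrite t1A t2A cl SA sub c2 subnKC// cS/=.
  by rewrite lerDl sumr_ge0// => z _; exact: weight_ge0.
apply: (@le_trans _ _ (\sum_(t1 in APs n r)
   \sum_(t2 in APs n r | (t2 != t1) && clash t1 t2)
     ext_cst_iter 2 (j - 2) * weight [set t2; t1]%SET)).
  apply: ler_sum => t1 _; apply: ler_sum => t2 /andP[_ /andP[t21 _]].
  rewrite (le_trans (sum_weight_supersets _ _))// cards2 t21//.
under eq_bigr do rewrite -mulr_sumr.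
by rewrite -mulr_sumr -mulrA ler_wpM2l ?ext_cst_iter_ge0// sum_weight_clash.
Qed.

(** * Comparison with the idealised model *)

Definition rare_points S : {set 'I_n} := [set (t : {ffun 'I_r -> 'I_n}) rare | t in S]%SET.

(* The probability of S in the idealised model: given the rare points, the
   progressions through them are coloured independently. *)
Definition star_weight S : R := N^-1 ^+ #|S| * N^-1 ^+ #|rare_points S|.

Definition common_graph t : {set 'I_n * C} :=
  [set (t s, a s) | s in [pred s | s != rare]]%SET.

(** The rare colour occurs at no other coordinate, so the pairs of rare colour correspond to the
    rare points, each of probability [N^-1]. *)
Lemma weight_split S :
  weight S = \prod_(x in \bigcup_(t in S) common_graph t) p x.2 *
             N^-1 ^+ #|rare_points S|.
Proof.
rewrite /weight /pair_weight (bigID (fun x => x.2 == a rare))/= mulrC.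
congr (_ * _).
  apply: eq_bigl => x; apply/andP/bigcupP => [[/bigcupP[t tS /imsetP[s _ ->]] /=]|].
    move=> as_; exists t => //; apply/imsetP; exists s => //.
    by rewrite inE; apply: contraNneq as_ => ->.
  move=> [t tS /imsetP[s]]; rewrite inE => sr ->; split; last exact: a_rare.
  by apply/bigcupP; exists t => //; apply/imsetP; exists s.
have -> (V : {set 'I_n}) : N^-1 ^+ #|V| =
    \prod_(x in [set (v, a rare) | v in V]%SET) p x.2.
  by rewrite -prodr_const big_imset/= ?pa_rare// => v v' _ _ [].
apply: eq_bigl => x; apply/andP/imsetP => [[/bigcupP[t tS /imsetP[s _ ->]] /=]|].
  have [->|/a_rare/negbTE ->//] := eqVneq s rare; exists (t rare) => //.
  by apply/imsetP; exists t.
move=> [v /imsetP[t tS ->] ->]; split=> //=.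
by apply/bigcupP; exists t => //; apply/imsetP; exists rare.
Qed.

Lemma prod_common t : t \in APs n r -> \prod_(x in common_graph t) p x.2 = N^-1.
Proof.
move=> tA; rewrite big_imset/= => [|s s' _ _ [/(AP_inj tA)]//].
exact: prod_pa_notrare.
Qed.

(** The non-rare pairs of one progression multiply to [N^-1]. In this form the idealised weight is
    the true one with each non-rare pair counted with multiplicity: it is smaller, and equal when
    nothing clashes. *)
Lemma star_weight_common S : S \subset APs n r ->
  star_weight S =
  \prod_(x in \bigcup_(t in S) common_graph t)
    p x.2 ^+ #|[set t in S | x \in common_graph t]%SET| *
  N^-1 ^+ #|rare_points S|.
Proof.
move=> SA; rewrite -prod_bigcup_mult /star_weight -prodr_const; congr (_ * _).
by apply: eq_bigr => t tS; rewrite prod_common// (fintype.subsetP SA).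
Qed.

Lemma star_weight_le S : S \subset APs n r -> star_weight S <= weight S.
Proof.
move=> SA; rewrite star_weight_common// weight_split ler_wpM2r ?exprn_ge0 ?Nv_ge0//.
apply: ler_prod => x /bigcupP[t tS xt]; rewrite exprn_ge0//=.
have /andP[q0 q1] : 0 <= p x.2 <= 1 by case/imsetP: xt => s _ ->; exact: q01.
have : (0 < #|[set t in S | x \in common_graph t]%SET|)%N.
  by rewrite card_gt0; apply/set0Pn; exists t; rewrite inE tS.
by case: #|_| => // m _; rewrite exprS ler_piMr// exprn_ile1.
Qed.

Lemma star_weight_eq S : S \subset APs n r -> ~~ clashing S ->
  star_weight S = weight S.
Proof.
move=> SA nc; rewrite star_weight_common// weight_split; congr (_ * _).
apply: eq_bigr => x /bigcupP[t tS xt].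
rewrite [#|_|](_ : _ = 1%N)//; apply/eqP/cards1P; exists t.
apply/setP => t'; rewrite !inE; apply/andP/eqP => [[t'S xt']|->//].
apply/eqP; apply: contraNT nc => tt.
apply/exists_inP; exists t => //; apply/exists_inP; exists t' => //; rewrite tt/=.
case/imsetP: xt => s; rewrite inE => sr xE.
case/imsetP: xt' => s' _; rewrite xE => -[ts _].
by apply/existsP; exists s; apply/existsP; exists s'; rewrite ts eqxx xpair_eqE (negbTE sr).
Qed.

Lemma graphs_fst_inj S : S \subset APs n r -> ~~ clashing S ->
  {in graphs S &, injective fst}.
Proof.
move=> SA nc x x' /bigcupP[t tS /imsetP[s _ ->]] /bigcupP[t' t'S /imsetP[s' _ ->]]/= tt.
have [t't|t't] := eqVneq t' t.
  by subst t'; rewrite (AP_inj (fintype.subsetP SA _ tS) tt).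
have [[sr s'r]|ne] := eqVneq (s, s') (rare, rare).
  by rewrite tt sr s'r.
case/negP: nc; apply/exists_inP; exists t => //; apply/exists_inP; exists t' => //.
by rewrite t't/=; apply/existsP; exists s; apply/existsP; exists s'; rewrite tt eqxx.
Qed.

Hypothesis p_sum1 : \sum_b p b = 1.

(** Without a clash the two terms of S agree; with one, both lie between 0 and [weight S]. *)
Lemma mass_star_weight_dist j :
  `|\sum_(S : {set {ffun 'I_r -> 'I_n}} | (S \subset APs n r) && (#|S| == j))
      \sum_(f | extends (graphs S) f) product_mass p f -
    \sum_(S : {set {ffun 'I_r -> 'I_n}} | (S \subset APs n r) && (#|S| == j))
      star_weight S| <= ext_cst_iter 2 (j - 2) * clash_cst * eps.
Proof.
apply: le_trans (sum_weight_clashing j).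
rewrite -sumrB (le_trans (ler_norm_sum _ _ _))//.
rewrite (bigID clashing)/= [X in _ + X]big1 ?addr0 => [|S /andP[/andP[SA _] nc]].
  rewrite [leRHS](eq_bigl (fun S => (S \subset APs n r) && (#|S| == j) && clashing S)).
    apply: ler_sum => S /andP[/andP[SA _] _].
    have h1 := mass_extends_le p_ge0 p_sum1 (graphs S).
    have h2 := star_weight_le SA.
    have h3 : 0 <= star_weight S by rewrite mulr_ge0 ?exprn_ge0 ?Nv_ge0.
    have h4 : 0 <= \sum_(f | extends (graphs S) f) product_mass p f.
      by apply: sumr_ge0 => f _; exact: product_mass_ge0.
    rewrite -/(weight S) in h1.
    by rewrite ler_norml; apply/andP; split; lra.
  by move=> S; rewrite andbA.
rewrite star_weight_eq// mass_extends_eq ?subrr ?normr0//.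
exact: graphs_fst_inj.
Qed.

(** The factor at [i] reads: with probability [N^-1] the point is rare, and then each progression
    through it is coloured independently with probability [N^-1]. *)
Lemma sum_star_weight (v : R) :
  \sum_(S : {set {ffun 'I_r -> 'I_n}} | S \subset APs n r) v ^+ #|S| * star_weight S =
  \prod_i (N^-1 * (1 + v / N) ^+
     #|[set t in APs n r | (t : {ffun 'I_r -> 'I_n}) rare == i]%SET| + (1 - N^-1)).
Proof.
rewrite -sum_subsets_image; apply: eq_bigr => S _.
by rewrite /star_weight mulrA -exprMn.
Qed.

End weights.

(** * Elementary estimates *)

(** A Bonferroni inequality. By Pascal's rule the error at (m + 1, J + 1) is the one at (m, J + 1)
    plus u times the one at (m, J), and the bounds obey the same recursion; the range of u gives the
    case J = 0. *)
Lemma binomial_truncation (R : realDomainType) (u : R) (m J : nat) :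
  -1 <= u <= 0 ->
  `|(1 + u) ^+ m - \sum_(j < J) 'C(m, j)%:R * u ^+ j| <= 'C(m, J)%:R * `|u| ^+ J.
Proof.
move=> /andP[u1 u0].
have v01 : 0 <= 1 + u <= 1 by apply/andP; split; lra.
have /andP[v0 v1] := v01.
elim: m J => [|m IH] [|J].
- by rewrite big_ord0 subr0 !expr0 normr1 bin0 mulr1.
- rewrite expr0 big_ord_recl bin0 big1 ?addr0 ?mulr1 ?subrr ?normr0//.
  by move=> i _; rewrite bin0n mul0r.
- rewrite big_ord0 subr0 expr0 bin0 mulr1 ger0_norm ?exprn_ge0//.
  exact: exprn_ile1.
- have -> : (1 + u) ^+ m.+1 - \sum_(j < J.+1) 'C(m.+1, j)%:R * u ^+ j =
    ((1 + u) ^+ m - \sum_(j < J.+1) 'C(m, j)%:R * u ^+ j) +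
    u * ((1 + u) ^+ m - \sum_(j < J) 'C(m, j)%:R * u ^+ j).
    rewrite [X in _ - X = _]big_ord_recl [X in _ = _ - X + _]big_ord_recl !bin0.
    under eq_bigr => i _ do rewrite lift0 binS natrD mulrDl.
    under [X in _ = _ - (_ + X) + _]eq_bigr => i _ do rewrite lift0.
    rewrite big_split/= exprS mulrBr mulr_sumr.
    under [X in _ = _ + (_ - X)]eq_bigr => i _ do rewrite mulrCA -exprS.
    by ring.
  rewrite (le_trans (ler_normD _ _))// normrM binS natrD mulrDl.
  rewrite lerD ?IH// exprS mulrCA ler_wpM2l ?IH//.
Qed.

Lemma dist_prod_le (R : numDomainType) (I : Type) (s : seq I) (x y : I -> R) :
  (forall i, 0 <= x i <= 1) -> (forall i, 0 <= y i <= 1) ->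
  `|\prod_(i <- s) x i - \prod_(i <- s) y i| <= \sum_(i <- s) `|x i - y i|.
Proof.
move=> x01 y01; elim: s => [|i s IH]; first by rewrite !big_nil subrr normr0.
rewrite !big_cons.
have -> : x i * \prod_(j <- s) x j - y i * \prod_(j <- s) y j =
  (x i - y i) * \prod_(j <- s) x j + y i * (\prod_(j <- s) x j - \prod_(j <- s) y j).
  by ring.
have /andP[yi0 yi1] := y01 i.
rewrite (le_trans (ler_normD _ _))// !normrM lerD//.
  rewrite ler_piMr// ger0_norm ?prodr_ile1 ?prodr_ge0// => j _.
  by have /andP[] := x01 j.
by rewrite (le_trans _ IH)// ler_piMl// ger0_norm.
Qed.

Lemma dist_exprn_le (R : numDomainType) (x y : R) (m : nat) :
  0 <= x <= 1 -> 0 <= y <= 1 -> `|x ^+ m - y ^+ m| <= m%:R * `|x - y|.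
Proof.
move=> x01 y01.
have prod_ord (z : R) : \prod_(i <- index_enum 'I_m) z = z ^+ m.
  by rewrite prodr_const card_ord.
have := @dist_prod_le R _ (index_enum 'I_m) (fun=> x) (fun=> y) (fun=> x01) (fun=> y01).
by rewrite !prod_ord sumr_const card_ord mulr_natl.
Qed.

Section expR_bounds.
Variable R : realType.
Implicit Types x y : R.

Lemma expRN_le1 x : 0 <= x -> 0 <= expR (- x) <= 1.
Proof. by move=> x0; rewrite expR_ge0/= -expR0 ler_expR oppr_le0. Qed.

(** From [1 + x <= expR x] one gets [expR (- x) - (1 - x) <= x * (1 - expR (- x))], and the last
    factor is at most x. *)
Lemma expRN_taylor1 x : 0 <= x <= 1 -> 0 <= expR (- x) - (1 - x) <= x ^+ 2.
Proof.
move=> /andP[x0 x1]; have h1 := expR_ge1Dx (- x); have h2 := expR_ge1Dx x.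
have e0 : 0 < expR (- x) by exact: expR_gt0.
have e : expR (- x) * expR x = 1 by rewrite -expRD addNr expR0.
apply/andP; split; first lra.
have := ler_wpM2l (ltW e0) h2; rewrite e; nra.
Qed.

Lemma dist_expRN x y : 0 <= x -> 0 <= y -> `|expR (- x) - expR (- y)| <= `|x - y|.
Proof.
wlog xy : x y / x <= y.
  move=> H x0 y0; have [/H|/ltW/H] := leP x y; first exact.
  by rewrite (distrC (expR _)) (distrC x) => h; exact: h.
move=> x0 y0; rewrite ger0_norm; last by rewrite subr_ge0 ler_expR lerN2.
rewrite distrC ger0_norm ?subr_ge0//.
have /andP[e0 e1] := expRN_le1 x0.
have -> : - y = - x + - (y - x) by lra.
rewrite expRD; have := expR_ge1Dx (- (y - x)); nra.
Qed.

End expR_bounds.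

(** * Progressions through a given rare point *)

Section rare_degree.
Variables (n r : nat) (s0 : 'I_r) (i : 'I_n).

Definition rare_degree : nat :=
  #|[set t in APs n r | (t : {ffun 'I_r -> 'I_n}) s0 == i]%SET|.

(** A progression with value [i] at [s0] is determined by its step, and the two inequalities say
    that it has room on the left and on the right; so the possible steps are 1, ..., m. *)
Lemma rare_degree_eq (m : nat) : (2 <= r)%N ->
  (forall d, (0 < d)%N ->
     ((d * s0 <= i)%N && (d * (r.-1 - s0) <= n.-1 - i)%N) = (d <= m)%N) ->
  rare_degree = m.
Proof.
move=> r2 mP; have i_n := ltn_ord i; have s0r := ltn_ord s0.
(* [k] stands for the step [k.+1]. The default [i] of [insubd] is never taken, as [fE] shows. *)
pose f (k : 'I_m) : {ffun 'I_r -> 'I_n} :=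
  [ffun s : 'I_r => insubd i (i - k.+1 * s0 + s * k.+1)%N].
have fE (k : 'I_m) (s : 'I_r) : f k s = (i - k.+1 * s0 + s * k.+1)%N :> nat.
  have /andP[h1 h2] : (k.+1 * s0 <= i)%N && (k.+1 * (r.-1 - s0) <= n.-1 - i)%N.
    by rewrite mP.
  rewrite ffunE val_insubd; case: ifP => // /negbT; rewrite -leqNgt => h3.
  have sr := ltn_ord s.
  have h4 : (s * k.+1 <= r.-1 * k.+1)%N by rewrite leq_mul2r; apply/orP; right; lia.
  by exfalso; nia.
have fi : injective f.
  move=> k k' /ffunP ff; apply: val_inj => /=.
  have := congr1 val (ff (Ordinal (ltnW r2))); have := congr1 val (ff (Ordinal r2)).
  by rewrite /= !fE/=; lia.
rewrite /rare_degree -[RHS]card_ord -(card_imset _ fi); apply: eq_card => t.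
rewrite !inE; apply/andP/imsetP => [[/APsP[x [d [d0 td]]] /eqP ti]|[k _ ->]].
  have tn : (t (Ordinal (ltac:(lia) : (r.-1 < r)%N)) < n)%N by [].
  rewrite td /= in tn; have := congr1 val ti; rewrite /= td => xi.
  have rr : (r.-1 = s0 + (r.-1 - s0))%N by lia.
  have dm : (d <= m)%N.
    rewrite -mP//; apply/andP; split; first by nia.
    by rewrite {}rr in tn; nia.
  have dm' : (d.-1 < m)%N by lia.
  exists (Ordinal dm') => //; apply/ffunP => s; apply: val_inj.
  by rewrite /= fE td/= prednK// -xi (mulnC s0) addnK.
have /andP[h1 h2] : (k.+1 * s0 <= i)%N && (k.+1 * (r.-1 - s0) <= n.-1 - i)%N.
  by rewrite mP.
split; last by apply/eqP/val_inj; rewrite /= fE (mulnC s0) subnK.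
by apply/APsP; exists (i - k.+1 * s0)%N, k.+1; split=> // s; rewrite fE.
Qed.

(** Of the 2, one unit pays for rounding down a quotient and one for the room on the right being
    [n.-1 - i] instead of [n - i]. *)
Lemma rare_degree_dist (R : realType) : (3 <= r)%N ->
  `|rare_degree%:R / n%:R - lambda s0 (i%:R / n%:R : R)| <= 2 / n%:R.
Proof.
move=> r3; have r2 : (2 <= r)%N by lia.
have n0 : (0 < n)%N by have := ltn_ord i; lia.
have i_n := ltn_ord i; have s0r := ltn_ord s0.
have N0 : 0 < n%:R :> R by rewrite ltr0n.
have N0' : n%:R != 0 :> R by rewrite gt_eqF.
have divB (m q : nat) : (0 < q)%N ->
    (m%:R / q%:R - 1 <= (m %/ q)%:R :> R) /\ ((m %/ q)%:R <= m%:R / q%:R :> R).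
  move=> q0; have q0' : 0 < q%:R :> R by rewrite ltr0n.
  rewrite lerBlDr ler_pdivrMr// ler_pdivlMr// natr1 -!natrM !ler_nat.
  by rewrite leq_divM mulSn {1}(divn_eq m q) addnC leq_add2r ltnW ?ltn_pmod.
have q1 : (0 < r.-1 - s0)%N -> 
    `|((n.-1 - i) %/ (r.-1 - s0))%:R / n%:R - (1 - i%:R / n%:R) / (r.-1 - s0)%:R|
    <= 2 / n%:R :> R.
  move=> q0; have [h1 h2] := divB (n.-1 - i)%N _ q0.
  have q0' : 1 <= (r.-1 - s0)%:R :> R by rewrite ler1n.
  have qv0 : 0 < (r.-1 - s0)%:R^-1 :> R by rewrite invr_gt0; lra.
  have qv1 : (r.-1 - s0)%:R^-1 <= 1 :> R by rewrite invf_le1//; lra.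
  set q := (r.-1 - s0)%:R in h1 h2 q0' qv0 qv1 *.
  have -> : (1 - i%:R / n%:R) / q = ((n%:R - i%:R) / q) / n%:R :> R.
    by field; rewrite N0'/= gt_eqF//; lra.
  rewrite -mulrBl normrM [X in _ * X <= _]ger0_norm ?invr_ge0 ?ler0n//.
  rewrite ler_wpM2r ?invr_ge0 ?ler0n//.
  have e : (n.-1 - i)%:R = n%:R - i%:R - 1 :> R.
    by rewrite natrB; [rewrite -subn1 natrB//; lra|lia].
  rewrite e mulrBl mul1r in h1 h2.
  by rewrite ler_norml; apply/andP; split; lra.
have q2 : (0 < s0)%N ->
    `|(i %/ s0)%:R / n%:R - i%:R / n%:R / s0%:R| <= 2 / n%:R :> R.
  move=> q0; have [h1 h2] := divB i _ q0.
  have -> : i%:R / n%:R / s0%:R = (i%:R / s0%:R) / n%:R :> R by rewrite mulrAC.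
  rewrite -mulrBl normrM [X in _ * X <= _]ger0_norm ?invr_ge0 ?ler0n//.
  rewrite ler_wpM2r ?invr_ge0 ?ler0n//.
  by rewrite ler_norml; apply/andP; split; lra.
rewrite /lambda; have [z|z] := eqVneq (s0 : nat) 0%N.
  rewrite (@rare_degree_eq ((n.-1 - i) %/ (r.-1 - s0))%N)//.
    by apply: q1; lia.
  by move=> d d0; rewrite z muln0 subn0 leq_divRL//; lia.
have [z'|z'] := eqVneq (s0 : nat) r.-1.
  rewrite (@rare_degree_eq (i %/ s0)%N)//.
    by apply: q2; lia.
  by move=> d d0; rewrite z' subnn muln0 andbT leq_divRL// -z'; lia.
have a1 : (0 < s0)%N by lia.
have a2 : (0 < r.-1 - s0)%N by lia.
rewrite (@rare_degree_eq (minn (i %/ s0) ((n.-1 - i) %/ (r.-1 - s0)))%N)//; last first.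
  by move=> d d0; rewrite leq_min !leq_divRL.
have {q1}:= q1 a2; have {q2} := q2 a1.
set A := (i %/ s0)%N; set B := ((n.-1 - i) %/ _)%N.
have -> : (minn A B)%:R / n%:R = Num.min (A%:R / n%:R) (B%:R / n%:R) :> R.
  rewrite /minn; case: ltnP => AB.
    by rewrite min_l// ler_wpM2r ?invr_ge0 ?ler0n// ler_nat ltnW.
  by rewrite min_r// ler_wpM2r ?invr_ge0 ?ler0n// ler_nat.
set x := i%:R / n%:R / s0%:R; set y := (1 - _) / _.
rewrite !ler_norml => /andP[? ?] /andP[? ?].
case: (leP (A%:R / n%:R : R) (B%:R / n%:R)) => ?; case: (leP x y) => ?; apply/andP; split; lra.
Qed.

End rare_degree.

(** * The generating function of the number of colourful progressions *)

Section colorful_pgf.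
Variables (R : realType) (n r : nat) (C : finType).
Variables (p : C -> R) (a : 'I_r -> C).
Implicit Types (t : {ffun 'I_r -> 'I_n}) (S : {set {ffun 'I_r -> 'I_n}}).
Implicit Types f : {ffun 'I_n -> C}.

Definition colorful_APs f : {set {ffun 'I_r -> 'I_n}} :=
  [set t in APs n r | [forall s, f (t s) == a s]]%SET.

Lemma sub_colorful_APs f S :
  (S \subset colorful_APs f) = (S \subset APs n r) && extends (graphs a S) f.
Proof.
apply/fintype.subsetP/andP => [SC|[/fintype.subsetP SA /forall_inP Sf] t tS].
  split; first by apply/fintype.subsetP => t /SC; rewrite inE => /andP[].
  apply/forall_inP => x /bigcupP[t tS /imsetP[s _ ->]] /=.
  by have := SC t tS; rewrite inE => /andP[_ /forallP].
rewrite inE SA//=; apply/forallP => s; apply: (Sf (t s, a s)).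
by apply/bigcupP; exists t => //; apply/imsetP; exists s.
Qed.

(** The binomial coefficient counts the j-element sets of colourful progressions; exchange the two
    sums. *)
Lemma binomial_moment j :
  \sum_f product_mass p f * 'C(#|colorful_APs f|, j)%:R =
  \sum_(S : {set {ffun 'I_r -> 'I_n}} | (S \subset APs n r) && (#|S| == j))
    \sum_(f | extends (graphs a S) f) product_mass p f.
Proof.
rewrite (exchange_big_dep xpredT)//=; apply: eq_bigr => f _.
rewrite -cards_draws mulr_natr -sumr_const; apply: eq_bigl => S.
by rewrite inE sub_colorful_APs andbAC.
Qed.

Definition colorful_pgf (z : R) : R :=
  \sum_f product_mass p f * z ^+ #|colorful_APs f|.

Hypotheses (n_gt0 : (0 < n)%N) (r_ge3 : (3 <= r)%N).
Variables (eps : R) (rare : 'I_r).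
Let N : R := n%:R.
Hypotheses (p_ge0 : forall b, 0 <= p b) (pa_eps : forall s, p (a s) <= eps).
Hypotheses (eps_le1 : eps <= 1) (prod_pa : \prod_s p (a s) = N ^- 2).
Hypotheses (pa_rare : p (a rare) = N^-1).
Hypotheses (a_rare : forall s, s != rare -> a s != a rare).
Hypothesis p_sum1 : \sum_b p b = 1.

Let N_gt0 : 0 < N. Proof. by rewrite ltr0n. Qed.
Let N_neq0 : N != 0. Proof. by rewrite gt_eqF. Qed.
Let Nv_ge0 : 0 <= N^-1. Proof. by rewrite invr_ge0 ler0n. Qed.
Let Nv_le1 : N^-1 <= 1. Proof. by rewrite invf_le1 ?ler1n. Qed.
Let r_ge2 : (2 <= r)%N. Proof. exact: ltnW. Qed.

Definition star_pgf (v : R) : R :=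
  \sum_(S : {set {ffun 'I_r -> 'I_n}} | S \subset APs n r)
    v ^+ #|S| * star_weight R rare S.

Definition star_moment j : R :=
  \sum_(S : {set {ffun 'I_r -> 'I_n}} | (S \subset APs n r) && (#|S| == j))
    star_weight R rare S.

Let star_ge0 S : 0 <= star_weight R rare S.
Proof. by rewrite mulr_ge0 ?exprn_ge0. Qed.

Definition clash_bound j : R := ext_cst_iter R r 2 (j - 2) * clash_cst R r.

Let eps_ge0 : 0 <= eps. Proof. exact: le_trans (pa_eps rare). Qed.

Lemma binomial_moment_dist j :
  `|\sum_f product_mass p f * 'C(#|colorful_APs f|, j)%:R - star_moment j|
  <= clash_bound j * eps.
Proof. by rewrite binomial_moment; apply: mass_star_weight_dist. Qed.

Lemma star_pgfE v :
  star_pgf v = \prod_(i < n) (N^-1 * (1 + v / N) ^+ rare_degree rare i + (1 - N^-1)).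
Proof. exact: sum_star_weight. Qed.

Lemma rare_degree_le (i : 'I_n) : (rare_degree rare i <= n)%N.
Proof. exact: card_APs_at. Qed.

(** At most n progressions pass through a rare point, so each factor is at most [1 + expR v / N],
    hence at most [expR (expR v / N)]. The bound is uniform in n. *)
Lemma star_pgf_le (v : R) : 0 <= v -> star_pgf v <= expR (expR v).
Proof.
move=> v0; have vN0 : 0 <= v / N by rewrite mulr_ge0.
have E1 : 1 <= (1 + v / N) by rewrite lerDl.
have bnd : expR v = expR (v / N) ^+ n by rewrite -expRM_natl mulrC divfK.
have -> : expR (expR v) = \prod_(i < n) expR (expR v / N).
  by rewrite prodr_const card_ord -expRM_natl mulrC divfK.
rewrite star_pgfE; apply: ler_prod => i _; apply/andP; split.
  by rewrite addr_ge0 ?subr_ge0// mulr_ge0 ?exprn_ge0// addr_ge0.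
have h : (1 + v / N) ^+ rare_degree rare i <= expR v.
  rewrite bnd (le_trans (ler_weXn2l E1 (rare_degree_le i)))//.
  by rewrite lerXn2r ?nnegrE ?expR_ge0 ?expR_ge1Dx// addr_ge0.
apply: le_trans (expR_ge1Dx _); rewrite (mulrC (expR v)) addrCA lerD2l.
by rewrite (le_trans _ (ler_wpM2l Nv_ge0 h))// gerDl oppr_le0.
Qed.

Let B := expR (expR (4 : R)).

(** Chernoff's argument: [4 ^+ J <= 4 ^+ #|S|] on the tail, so it is at most [4 ^- J] times the
    generating function at 4. Any constant above 1 would serve. *)
Lemma star_tail (u : R) J : `|u| <= 1 ->
  \sum_(S : {set {ffun 'I_r -> 'I_n}} | (S \subset APs n r) && (J <= #|S|)%N)
    `|u| ^+ #|S| * star_weight R rare S <= 4 ^- J * B.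
Proof.
move=> u1; rewrite ler_pdivlMl ?exprn_gt0//.
apply: (@le_trans _ _ (star_pgf 4)); last by apply: star_pgf_le.
rewrite mulr_sumr /star_pgf [leRHS](bigID (fun S => J <= #|S|)%N)/=.
rewrite -[leLHS]addr0 lerD//; last first.
  by apply: sumr_ge0 => S _; rewrite mulr_ge0// exprn_ge0.
apply: ler_sum => S /andP[_ JS]; rewrite mulrA ler_wpM2r//.
rewrite -[leRHS]mulr1 ler_pM ?exprn_ge0// ?exprn_ile1//.
by rewrite ler_weXn2l// ler1n.
Qed.

Lemma star_moment_le J : star_moment J <= 4 ^- J * B.
Proof.
apply: le_trans (@star_tail 1 J _); last by rewrite normr1.
rewrite [leRHS](bigID (fun S : {set {ffun 'I_r -> 'I_n}} => #|S| == J))/=.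
rewrite -[leLHS]addr0 lerD//; last first.
  by apply: sumr_ge0 => S _; rewrite mulr_ge0// exprn_ge0.
rewrite /star_moment [leLHS](eq_bigl (fun S : {set {ffun 'I_r -> 'I_n}} =>
    (S \subset APs n r) && (J <= #|S|)%N && (#|S| == J))) => [|S].
  by apply: ler_sum => S _; rewrite normr1 expr1n mul1r.
by rewrite -andbA; congr (_ && _); case: eqP => [->|]; rewrite ?leqnn ?andbF.
Qed.

Lemma star_pgf_trunc (u : R) J : `|u| <= 1 ->
  `|star_pgf u - \sum_(j < J) u ^+ j * star_moment j| <= 4 ^- J * B.
Proof.
move=> u1.
have -> : \sum_(j < J) u ^+ j * star_moment j =
  \sum_(S : {set {ffun 'I_r -> 'I_n}} | (S \subset APs n r) && ~~ (J <= #|S|)%N)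
    u ^+ #|S| * star_weight R rare S.
  under eq_bigr do rewrite mulr_sumr.
  rewrite (exchange_big_dep (fun S : {set {ffun 'I_r -> 'I_n}} =>
    (S \subset APs n r) && ~~ (J <= #|S|)%N))/= => [|j S _ /andP[->/= /eqP ->]]; last first.
    by rewrite -ltnNge.
  apply: eq_bigr => S /andP[SA]; rewrite -ltnNge => SJ.
  rewrite (big_pred1 (Ordinal SJ))//= => j.
  by rewrite SA/= -val_eqE/= eq_sym.
rewrite /star_pgf (bigID (fun S => J <= #|S|)%N)/= addrK.
apply: le_trans (star_tail J u1).
rewrite (le_trans (ler_norm_sum _ _ _))//; apply: ler_sum => S _.
by rewrite normrM normrX (ger0_norm (star_ge0 _)).
Qed.

Lemma colorful_pgf_trunc (u : R) J : -1 <= u <= 0 ->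
  `|colorful_pgf (1 + u) - \sum_(j < J) u ^+ j *
      \sum_f product_mass p f * 'C(#|colorful_APs f|, j)%:R| <=
  \sum_f product_mass p f * 'C(#|colorful_APs f|, J)%:R.
Proof.
move=> u10; have u1 : `|u| <= 1 by rewrite ler_norml; apply/andP; split; lra.
have -> : \sum_(j < J) u ^+ j *
      (\sum_f product_mass p f * 'C(#|colorful_APs f|, j)%:R) =
    \sum_f product_mass p f * \sum_(j < J) 'C(#|colorful_APs f|, j)%:R * u ^+ j.
  under eq_bigr do rewrite mulr_sumr.
  rewrite exchange_big/=; apply: eq_bigr => f _; rewrite mulr_sumr.
  by apply: eq_bigr => j _; ring.
rewrite /colorful_pgf -sumrB (le_trans (ler_norm_sum _ _ _))//.
apply: ler_sum => f _; rewrite -mulrBr normrM ger0_norm ?product_mass_ge0//.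
rewrite ler_wpM2l ?product_mass_ge0// (le_trans (binomial_truncation _ _ u10))//.
by rewrite ler_piMr// exprn_ile1.
Qed.

(** Both generating functions are truncated at order J. One [4 ^- J * B] is the tail of the
    idealised model; the other bounds its J-th moment, which with an error [clash_bound J * eps]
    controls the truncation for the colouring, hence [J.+1] terms. *)
Lemma colorful_star_pgf_dist (u : R) J : -1 <= u <= 0 ->
  `|colorful_pgf (1 + u) - star_pgf u| <=
    (\sum_(j < J.+1) clash_bound j) * eps + 2 * (4 ^- J * B).
Proof.
move=> u10; have u1 : `|u| <= 1 by rewrite ler_norml; apply/andP; split; lra.
pose e j := \sum_f product_mass p f * 'C(#|colorful_APs f|, j)%:R.
pose Se := \sum_(j < J) u ^+ j * e j.
pose Ss := \sum_(j < J) u ^+ j * star_moment j.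
have h1 : `|colorful_pgf (1 + u) - Se| <= e J := colorful_pgf_trunc J u10.
have h2 : `|star_pgf u - Ss| <= 4 ^- J * B := star_pgf_trunc J u1.
have h4 : `|e J - star_moment J| <= clash_bound J * eps := binomial_moment_dist J.
have h3 := star_moment_le J.
rewrite big_ord_recr/= mulrDl.
have : `|Se - Ss| <= (\sum_(j < J) clash_bound j) * eps.
  rewrite /Se /Ss -sumrB (le_trans (ler_norm_sum _ _ _))// mulr_suml.
  apply: ler_sum => j _; rewrite -mulrBr normrM.
  rewrite (le_trans _ (binomial_moment_dist j))// ler_piMl// normrX exprn_ile1//.
clearbody Se Ss e; move: h1 h2 h3 h4.
move: (colorful_pgf _) (star_pgf _) (star_moment J) (4 ^- J * B) (clash_bound J * eps).
move: ((\sum_(j < J) clash_bound j) * eps) => x1 x2 x3 x4 x5 x6.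
by rewrite !ler_norml => /andP[? ?] /andP[? ?] ? /andP[? ?] /andP[? ?]; apply/andP; split; lra.
Qed.

(** A Riemann sum for the generating function of the limit at [1 + u], the exponential of the
    integral of [expR (u * lambda x) - 1] over [0, 1]. Both sides are compared with such sums, so
    the integral itself is never evaluated. *)
Definition riemann_pgf (m : nat) (u : R) : R :=
  expR (m%:R^-1 * \sum_(i < m) (expR (u * lambda rare (i%:R / m%:R)) - 1)).

(** Each of the n factors differs by at most [4 / N ^+ 2]: one unit for replacing [1 + u / N] by
    [expR (u / N)], two for the degree against [lambda], one for [1 - y] against [expR (- y)]. *)
Lemma star_riemann_dist (u : R) : -1 <= u <= 0 ->
  `|star_pgf u - riemann_pgf n u| <= 4 / N.
Proof.
move=> u10; have /andP[u1 u0] := u10.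
have lam0 (i : 'I_n) : 0 <= lambda rare (i%:R / N).
  have x0 : 0 <= i%:R / N by rewrite mulr_ge0.
  have x1 : i%:R / N <= 1 by rewrite ler_pdivrMr// mul1r ler_nat ltnW.
  rewrite /lambda; case: ifP => _; first by rewrite mulr_ge0 ?subr_ge0 ?invr_ge0.
  case: ifP => _; first by rewrite mulr_ge0 ?invr_ge0.
  by rewrite le_min !mulr_ge0 ?subr_ge0 ?invr_ge0.
rewrite /riemann_pgf mulr_sumr expR_sum star_pgfE.
pose h (i : 'I_n) := expR (u * lambda rare (i%:R / N)).
have h01 i : 0 <= h i <= 1.
  have := @expRN_le1 _ (- u * lambda rare (i%:R / N)).
  by rewrite mulNr opprK; apply; rewrite -mulNr mulr_ge0 ?lam0//; lra.
have y01 i : 0 <= N^-1 * (1 - h i) <= 1.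
  have /andP[? ?] := h01 i; apply/andP; split; first by rewrite mulr_ge0//; lra.
  by rewrite mulr_ile1//; lra.
have yE i : expR (N^-1 * (h i - 1)) = expR (- (N^-1 * (1 - h i))).
  by congr expR; ring.
have w01 : 0 <= 1 + u / N <= 1.
  have : 0 <= N^-1 * (1 + u) by rewrite mulr_ge0//; lra.
  have : 0 <= N^-1 * (- u) by rewrite mulr_ge0//; lra.
  by rewrite mulrDr mulr1 mulrN (mulrC u); move: Nv_le1 => *; apply/andP; split; lra.
apply: le_trans (dist_prod_le _ _ _) _.
- move=> i; have : 0 <= (1 + u / N) ^+ rare_degree rare i <= 1.
    by have /andP[? ?] := w01; rewrite exprn_ge0// exprn_ile1.
  move=> /andP[? ?]; apply/andP; split; first by rewrite addr_ge0 ?mulr_ge0// subr_ge0.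
  by rewrite addrCA gerDl subr_le0 ler_piMr.
- by move=> i; rewrite -/(h i) yE; apply: expRN_le1; have /andP[] := y01 i.
have -> : 4 / N = \sum_(i < n) 4 / N ^+ 2.
  by rewrite sumr_const card_ord -mulr_natl; field.
apply: ler_sum => i _; rewrite -/(h i) yE.
have := expRN_taylor1 (y01 i); set y := N^-1 * (1 - h i).
have yN : y ^+ 2 <= N ^- 2.
  rewrite /y exprMn exprVn ler_piMr ?invr_ge0 ?exprn_ge0//.
  by have /andP[? ?] := h01 i; rewrite exprn_ile1//; lra.
have d1 : `|(1 + u / N) ^+ rare_degree rare i - h i| <= 3 / N.
  have e1 : 0 <= expR (u / N) <= 1.
    have := @expRN_le1 _ (- u / N); rewrite mulNr opprK; apply.
    by rewrite -mulNr mulr_ge0//; lra.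
  rewrite -(subrKA (expR (u / N) ^+ rare_degree rare i)).
  have -> : 3 / N = N^-1 + 2 / N by ring.
  rewrite (le_trans (ler_normD _ _))// lerD//.
    rewrite (le_trans (dist_exprn_le _ w01 e1))//.
    apply: (@le_trans _ _ (N * N ^- 2)); last by rewrite expr2 invfM mulVKf.
    rewrite ler_pM// ?ler_nat ?rare_degree_le//.
    have := @expRN_taylor1 _ (- u / N); rewrite mulNr opprK.
    have u01 : 0 <= - (u / N) <= 1.
      have : 0 <= N^-1 * (- u) by rewrite mulr_ge0//; lra.
      have : N^-1 * (- u) <= 1 by rewrite mulr_ile1//; lra.
      by rewrite mulrN (mulrC u) => *; apply/andP; split; lra.
    move=> /(_ u01)/andP[? ?]; rewrite distrC ger0_norm//.
    apply: (@le_trans _ _ ((- (u / N)) ^+ 2)) => //.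
    rewrite sqrrN exprMn exprVn ler_piMl ?invr_ge0 ?exprn_ge0//.
    by rewrite -sqrrN exprn_ile1//; lra.
  rewrite -expRM_natl /h.
  have -> : (rare_degree rare i)%:R * (u / N) =
    - (- u * ((rare_degree rare i)%:R / N)).
    by rewrite mulNr opprK mulrCA.
  have -> : u * lambda rare (i%:R / N) = - (- u * lambda rare (i%:R / N)) by ring.
  have nu0 : 0 <= - u by lra.
  rewrite (le_trans (dist_expRN _ _))// ?(mulr_ge0 nu0) ?lam0 ?mulr_ge0//.
  rewrite -mulrBr normrM (le_trans _ (@rare_degree_dist n r rare i R r_ge3))//.
  by rewrite ler_piMl// normrN ler_norml; apply/andP; split; lra.
have := ler_wpM2l Nv_ge0 d1; rewrite -[X in X * _ <= _ -> _]ger0_norm// -normrM.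
have -> : N^-1 * (3 / N) = 3 / N ^+ 2 by field.
move: ((1 + u / N) ^+ _) => x; rewrite !ler_norml => /andP[? ?] /andP[? ?].
have -> : N^-1 * x + (1 - N^-1) = N^-1 * (x - h i) + (1 - y) by rewrite /y; ring.
have -> : 4 / N ^+ 2 = 3 / N ^+ 2 + N ^- 2 by ring.
by apply/andP; split; lra.
Qed.

Lemma colorful_riemann_dist (u : R) J : -1 <= u <= 0 ->
  `|colorful_pgf (1 + u) - riemann_pgf n u| <=
    (\sum_(j < J.+1) clash_bound j) * eps + 2 * (4 ^- J * B) + 4 / N.
Proof.
move=> u10; rewrite -(subrKA (star_pgf u)) (le_trans (ler_normD _ _))//.
by rewrite lerD ?colorful_star_pgf_dist ?star_riemann_dist.
Qed.

End colorful_pgf.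

Local Open Scope classical_set_scope.
Local Open Scope ring_scope.

(** * Sums over sequences *)

Section esum_tools.
Context {R : realType}.
Local Open Scope ereal_scope.

Lemma esumZl (T : choiceType) (S : set T) (c : R) (a : T -> \bar R) :
  (0 <= c)%R -> (forall x, 0 <= a x) ->
  \esum_(x in S) (c%:E * a x) = c%:E * \esum_(x in S) a x.
Proof.
move=> c0 a0; rewrite /esum -ereal_supZl//; last first.
  by apply/set0P; exists (\sum_(x \in set0) a x); exists set0 => //; split.
congr ereal_sup; apply/seteqP; split=> [_ [X SX <-]|_ [_ [X SX <-] <-]]/=.
  exists (\sum_(x \in X) a x); first by exists X.
  by rewrite ge0_mule_fsumr.
by exists X => //; rewrite ge0_mule_fsumr.
Qed.

Lemma esum_countType (T : countType) (a : T -> \bar R) : (forall x, 0 <= a x) ->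
  \esum_(x in setT) a x = \sum_(k <oo) oapp a 0 (pickle_inv k).
Proof.
move=> a0; rewrite nneseries_esumT; last by move=> k; case: pickle_inv.
have -> : \esum_(x in [set: T]) a x =
    \esum_(x in [set: T]) oapp a 0 (pickle_inv (choice.pickle x)).
  by apply: eq_esum => x _; rewrite pickleK_inv.
rewrite -(@esum_image _ _ _ setT choice.pickle (fun k => oapp a 0 (pickle_inv k))).
  rewrite esum_mkcond; apply: eq_esum => k _; case: ifPn => //.
  rewrite notin_setE/= => kT; case kE : (pickle_inv k) => [x|]//=.
  by case: kT; exists x => //; have := @pickle_invK T k; rewrite kE.
by move=> x y _ _; exact: (pcan_inj pickleK_inv).
Qed.

(** Enumerating the countable index type turns this into monotone convergence for a series. *)
Lemma integral_esum d (Omega : measurableType d)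
    (mu : {measure set Omega -> \bar R}) (T : countType) (W : T -> Omega -> \bar R) :
  (forall v, measurable_fun setT (W v)) -> (forall v w, 0 <= W v w) ->
  \int[mu]_w (\esum_(v in setT) W v w) = \esum_(v in setT) (\int[mu]_w W v w).
Proof.
move=> mW W0; rewrite esum_countType => [|v]; last exact: integral_ge0.
under eq_integral => w _ do rewrite esum_countType//.
rewrite integral_nneseries//.
- apply: eq_eseriesr => k _; case: pickle_inv => //=.
  by rewrite integral0.
- by move=> k; case: pickle_inv => //=; exact: measurable_cst.
- by move=> k w _; case: pickle_inv => //=.
Qed.

Lemma esum_one (T : choiceType) (S : set T) (v0 : T) (a : T -> \bar R) :
  S v0 -> 0 <= a v0 -> (forall v, v <> v0 -> a v = 0) ->
  \esum_(v in S) a v = a v0.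
Proof.
move=> Sv0 a0 av; rewrite -(esum_set1 (T := T))//.
rewrite esum_mkcond [RHS]esum_mkcond; apply: eq_esum => v _.
have [->|/eqP vv0] := eqVneq v v0; first by rewrite !mem_set.
by rewrite av//; do 2 case: ifP.
Qed.

(** Distributivity for infinite sums, by splitting a sequence into head and tail. The families are
    indexed by all natural numbers so that the induction can shift them. *)
Lemma esum_seq_prod (k : nat) (f : nat -> nat -> \bar R) (F : nat -> R) :
  (forall i j, 0 <= f i j) ->
  (forall i, \esum_(j in setT) f i j = (F i)%:E) ->
  \esum_(m in [set m : seq nat | size m = k]) \prod_(i < k) f i (nth 0%N m i) =
  \prod_(i < k) (F i)%:E.
Proof.
elim: k f F => [|k IH] f F f0 fF.
  rewrite (_ : [set _ | _] = [set [::]]); last first.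
    by apply/seteqP; split => [[]//|_ ->].
  by rewrite esum_set1 !big_ord0.
have F0 i : (0 <= F i)%R by rewrite -lee_fin -fF esum_ge0.
rewrite (@reindex_esum _ _ _ (setT `*` [set m : seq nat | size m = k]) _
   (fun x => x.1 :: x.2)); last first.
  split=> [[j m] [_ /= <-]//|[j m] [j' m'] _ _ [-> ->]//|[|j m]//= [mk]].
  by exists (j, m).
have -> : setT `*` [set m : seq nat | size m = k] =
   setT `*`` (fun=> [set m : seq nat | size m = k]) by [].
rewrite -(esum_esum (a := fun j m =>
  \prod_(i < k.+1) f i (nth 0%N (j :: m) i))); last first.
  by move=> j m _ _; exact: prode_ge0.
have fin0 j : (f 0%N j) \is a fin_num.
  rewrite ge0_fin_numE// (le_lt_trans _ (ltry (F 0%N)))// -fF.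
  rewrite -[leLHS](@esum_set1 _ _ j (f 0%N))//.
  rewrite esum_mkcond [leRHS]esum_mkcond; apply: le_esum => i _.
  by rewrite in_setT; case: ifP.
have step j : \esum_(m in [set m : seq nat | size m = k])
    \prod_(i < k.+1) f i (nth 0%N (j :: m) i) =
    (\prod_(i < k) F i.+1)%:E * f 0%N j.
  rewrite muleC -prodEFin -(IH (fun i => f i.+1) (fun i => F i.+1))//.
  rewrite -[in RHS](fineK (fin0 j)) -esumZl ?fine_ge0//; last first.
    by move=> m; exact: prode_ge0.
  apply: eq_esum => m _; rewrite big_ord_recl fineK//; congr (_ * _).
under eq_esum => j _ do rewrite step.
rewrite esumZl ?fF ?prodr_ge0// big_ord_recl muleC -prodEFin.
by congr (_ * _); apply: eq_bigr => i _; rewrite lift0.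
Qed.

End esum_tools.

(** * Poisson masses and their generating function *)

Section poisson_mass.
Context {R : realType}.
Implicit Types (rate z : R) (k : nat).

(** As [0 ^+ 0 = 1], this is the point mass at 0 for rate 0, so that no case distinction is needed
    later. *)
Definition poisson_mass rate k : R := rate ^+ k * k`!%:R^-1 * expR (- rate).

Lemma poisson_mass_ge0 rate k : 0 <= rate -> 0 <= poisson_mass rate k.
Proof. by move=> r0; rewrite /poisson_mass !mulr_ge0 ?exprn_ge0 ?expR_ge0. Qed.

Lemma PoisE rate (U : set nat) : Pois rate U =
  if 0 < rate then (\esum_(k in U) (poisson_pmf rate k)%:E)%E else \d_0%N U.
Proof. by []. Qed.

Lemma Pois1 rate k : 0 <= rate -> Pois rate [set k] = (poisson_mass rate k)%:E.
Proof.
rewrite PoisE le_eqVlt => /orP[/eqP <-|r0].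
  rewrite ltxx /poisson_mass oppr0 expR0 mulr1 diracE.
  case: k => [|k]; first by rewrite expr0 fact0 invr1 mulr1 mem_set.
  by rewrite exprS !mul0r memNset.
rewrite r0 esum_set1 ?lee_fin ?poisson_pmf_ge0//.
by rewrite /poisson_pmf r0.
Qed.

Lemma esum_poisson_mass rate : 0 <= rate ->
  (\esum_(k in setT) (poisson_mass rate k)%:E = 1)%E.
Proof.
move=> r0; move: (r0); rewrite le_eqVlt => /orP[/eqP <-|r1].
  rewrite (@esum_one _ _ _ 0%N)//.
  - by rewrite /poisson_mass expr0 fact0 invr1 !mul1r oppr0 expR0.
  - by rewrite lee_fin poisson_mass_ge0.
  - by move=> [|k]// _; rewrite /poisson_mass exprS !mul0r.
rewrite -(@probability_setT _ _ _ (Pois rate)) PoisE r1.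
by apply: eq_esum => k _; rewrite /poisson_mass /poisson_pmf r1.
Qed.

(** Tilting: up to the factor [expR (rate * (z - 1))], the terms are the Poisson masses of rate
    [z * rate], which sum to 1. *)
Lemma esum_poisson_pgf rate z : 0 <= rate -> 0 <= z ->
  (\esum_(k in setT) (z ^+ k * poisson_mass rate k)%:E =
   (expR (rate * (z - 1)))%:E)%E.
Proof.
move=> r0 z0.
have e k : z ^+ k * poisson_mass rate k =
    expR (rate * (z - 1)) * poisson_mass (z * rate) k.
  rewrite /poisson_mass exprMn.
  have -> : expR (- rate) = expR (rate * (z - 1)) * expR (- (z * rate)).
    by rewrite -expRD; congr expR; ring.
  by ring.
under eq_esum => k _ do rewrite e EFinM.
rewrite esumZl ?expR_ge0//; last by move=> k; rewrite lee_fin poisson_mass_ge0 ?mulr_ge0.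
by rewrite esum_poisson_mass ?mule1// mulr_ge0.
Qed.

End poisson_mass.

(** * Independent discrete variables *)

Section discrete_expectation.
Context d (Omega : measurableType d) (R : realType) (P : probability Omega R).

Lemma measurable_discrete_comp (T : Type) d1 (T1 : measurableType d1)
    (Y : Omega -> T) (g : T -> T1) :
  discrete_measurable_fun Y -> measurable_fun setT (g \o Y).
Proof. by move=> mY _ B mB; rewrite setTI comp_preimage; exact: mY. Qed.

Lemma integral_indicZl (c : R) (A : set Omega) : 0 <= c -> measurable A ->
  (\int[P]_w (c%:E * (\1_A w)%:E) = c%:E * P A)%E.
Proof.
move=> c0 mA; rewrite ge0_integralZl_EFin//; last first.
  by apply/measurable_EFinP; exact: measurable_indic.
by rewrite integral_indic// setIT.
Qed.

Lemma discrete_independent_expectation (k : nat) (Y : 'I_k -> Omega -> nat)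
    (f : nat -> nat -> R) (F : nat -> R) :
  (forall i j, 0 <= f i j) ->
  (forall i, discrete_measurable_fun (Y i)) ->
  discrete_independent P Y ->
  (forall i : 'I_k,
    \esum_(j in setT) ((f i j)%:E * P [set w | Y i w = j]) = (F i)%:E)%E ->
  (\int[P]_w (\prod_(i < k) f i (Y i w))%:E = (\prod_(i < k) F i)%:E)%E.
Proof.
move=> f0 mY indY fF.
pose E (m : seq nat) := \bigcap_(i : 'I_k) (Y i @^-1` [set nth 0%N m i]).
(* [E m] sees only the first k entries, padded with zeros; fixing the length makes these events
   disjoint. *)
pose E' (m : seq nat) := if size m == k then E m else set0.
have mE m : measurable (E m) by apply: fin_bigcap_measurable => [|i _]; [exact: finite_finset|exact: mY].
have mE' m : measurable (E' m) by rewrite /E'; case: ifP.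
have c0 (m : seq nat) : 0 <= \prod_(i < k) f i (nth 0%N m i).
  by apply: prodr_ge0.
have PE m : P (E m) = (\prod_(i < k) P (Y i @^-1` [set nth 0%N m i]))%E.
  rewrite /E; have := indY [set: 'I_k]%SET (fun i => [set nth 0%N m i]).
  rewrite (_ : [set` [set: 'I_k]%SET] = setT); last first.
    by apply/seteqP; split => i //=; rewrite inE.
  by move=> ->; apply: eq_bigl => i; rewrite inE.
pose W (m : seq nat) w :=
  ((\prod_(i < k) f i (nth 0%N m i))%:E * (\1_(E' m) w)%:E)%E.
have -> : (\int[P]_w (\prod_(i < k) f i (Y i w))%:E =
    \int[P]_w \esum_(m in [set: seq nat]) W m w)%E.
  apply: eq_integral => w _.
  pose m0 := [seq Y i w | i <- enum 'I_k].
  have nth_m0 (i : 'I_k) : nth 0%N m0 i = Y i w.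
    by rewrite (nth_map i) ?size_enum_ord// nth_ord_enum.
  have sm0 : size m0 = k by rewrite size_map size_enum_ord.
  rewrite (esum_one (v0 := m0))//.
  - rewrite /W /indic mem_set ?mule1; last by rewrite /E' sm0 eqxx => i _ /=.
    by congr (_%:E); apply: eq_bigr => i _; rewrite nth_m0.
  - by rewrite mule_ge0 ?lee_fin.
  - move=> m mm0; rewrite /W /indic memNset ?mule0// /E'; case: eqP => [sm Em|_ []].
    apply: mm0; apply: (@eq_from_nth _ 0%N); first by rewrite sm sm0.
    move=> i; rewrite sm => ik; have := Em (Ordinal ik) I; rewrite /= => <-.
    by rewrite -[i in RHS]/(nat_of_ord (Ordinal ik)) nth_m0.
have intW : (\int[P]_w (\esum_(m in [set: seq nat]) W m w) =
    \esum_(m in [set: seq nat]) (\int[P]_w W m w))%E.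
  apply: integral_esum.
  - by move=> m; apply: emeasurable_funM => //; apply/measurable_EFinP;
      exact: measurable_indic.
  - by move=> m w; rewrite mule_ge0 ?lee_fin.
rewrite intW.
under eq_esum => m _ do rewrite /W integral_indicZl//.
pose f' i j := (if (insub i : option 'I_k) is Some i' then
   (f i j)%:E * P [set w | Y i' w = j] else 0)%E.
pose F' i := if (i < k)%N then F i else 0.
have f'E (i : 'I_k) j : f' i j = ((f i j)%:E * P [set w | Y i w = j])%E.
  by rewrite /f' valK.
rewrite (_ : (\prod_(i < k) F i)%:E = \prod_(i < k) (F' i)%:E)%E; last first.
  by rewrite -prodEFin; apply: eq_bigr => i _; rewrite /F' ltn_ord.
rewrite -(@esum_seq_prod _ k f' F').
- rewrite [RHS]esum_mkcond; apply: eq_esum => m _; rewrite /E'.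
  have [sm|sm] := eqVneq (size m) k; last first.
    by rewrite memNset ?measure0 ?mule0// => /eqP; exact/negP.
  rewrite mem_set// PE -prodEFin -big_split/=.
  by apply: eq_bigr => i _; rewrite f'E.
- by move=> i j; rewrite /f'; case: insub => // i'; rewrite mule_ge0 ?lee_fin.
- move=> i; rewrite /f' /F'; case: insubP => [i' ik ii'|/negbTE ->].
    by rewrite ik -ii' fF.
  by rewrite esum1.
Qed.

End discrete_expectation.

(** * Marked points *)

Section marks.
Context d (Omega : measurableType d) (R : realType) (P : probability Omega R).
Variables (PP : Omega -> {fset R}) (N : Omega -> R -> nat).
Hypothesis hPP : poisson_point_process P `[0, 1] 1 PP.

Let PP01 w x : x \in PP w -> 0 <= x <= 1.
Proof. by case: hPP => + _ _ _ => /[apply] /=; rewrite in_itv. Qed.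

Lemma num_points01 w : num_points PP `[0, 1] w = size (PP w).
Proof.
apply/eqP; rewrite -all_count; apply/allP => x /PP01 x01.
by rewrite mem_set//= in_itv.
Qed.

Lemma measurable_size_points k : measurable [set w | size (PP w) = k].
Proof.
have mN : discrete_measurable_fun (num_points PP `[0, 1]).
  by case: hPP => _ + _ _; apply; [exact: measurable_itv|exact: subset_refl].
rewrite (_ : [set w | _] = num_points PP `[0, 1] @^-1` [set k]); first exact: mN.
by apply/seteqP; split => w /=; rewrite num_points01.
Qed.

(** The point of index i is below x exactly when more than i points are, which is an event about
    counts. *)
Lemma measurable_sorted_points i :
  measurable_fun setT (fun w => nth 0 (sorted_points PP w) i).
Proof.
apply: (measurability _ (RGenInftyO.measurableE R)) => //.
move=> _ [_ [x ->] <-]; rewrite setTI.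
pose B : set R := `[0, 1] `&` `]-oo, x[.
have mB : measurable B by apply: measurableI; exact: measurable_itv.
have mN : discrete_measurable_fun (num_points PP B).
  by case: hPP => _ + _ _ => /(_ B mB); apply; exact: subIsetl.
have cntE w : count (< x) (sorted_points PP w) = num_points PP B w.
  rewrite /num_points /sorted_points (permP (permEl (perm_sort _ _))).
  apply: eq_in_count => y yP; have y01 := PP01 yP.
  apply/idP/idP => [yx|]; first by rewrite mem_set//; split; rewrite /= in_itv.
  by rewrite inE => -[_]; rewrite /= in_itv.
(* With at most i points [nth] returns its default 0, which is below x only if [0 < x]: hence the
   second set. *)
have -> : (fun w => nth 0 (sorted_points PP w) i) @^-1` `]-oo, x[ =
    (num_points PP B @^-1` [set m | (i < m)%N]) `|`
    (if 0 < x then \bigcup_(k in [set k | (k <= i)%N]) [set w | size (PP w) = k]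
     else set0).
  have ss w : sorted <=%R (sorted_points PP w) by exact: sort_le_sorted.
  have sz w : size (sorted_points PP w) = size (PP w) by rewrite size_sort.
  apply/seteqP; split => w /=; rewrite in_itv/=.
    move=> wx; have [iN|Ni] := ltnP i (num_points PP B w); first by left.
    right; have [si|is_] := leqP (size (PP w)) i.
      by rewrite nth_default ?sz// in wx; rewrite wx; exists (size (PP w)).
    have := @nth_count_ge _ _ x 0 _ i (ss w).
    by rewrite cntE Ni sz is_ => /(_ isT); rewrite leNgt wx.
  move=> [iN|]; first by apply: nth_count_lt; rewrite ?cntE.
  by case: ifP => // x0 [k /= ki sk]; rewrite nth_default// sz sk.
apply: measurableU; first exact: mN.
case: ifP => // _; apply: bigcup_measurable => k _; exact: measurable_size_points.
Qed.

Lemma prod_sorted_points (h : R -> R) w :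
  \prod_(x <- sorted_points PP w) h x = \prod_(x <- PP w) h x.
Proof. by apply: perm_big; rewrite perm_sort. Qed.

Variable lam : R -> R.
Hypothesis mlam : measurable_fun setT lam.
Hypothesis lam_ge0 : forall x, 0 <= x <= 1 -> 0 <= lam x.
Hypothesis hN : cond_independent_poisson_marks P lam PP N.

Lemma total_mark_marks w : total_mark PP N w = sumn (marks PP N w).
Proof.
rewrite sumnE /marks big_map /total_mark.
by apply/esym/perm_big; rewrite perm_sort.
Qed.

Lemma measurable_total_mark : discrete_measurable_fun (total_mark PP N).
Proof.
move=> B.
rewrite (_ : _ @^-1` B = \bigcup_(m : seq nat)
  (if sumn m \in B then [set w | marks PP N w = m] else set0)).
  apply: countable_bigcupT_measurable => [|m]; first exact: countableP.
  by case: ifP => // _; case: (hN m).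
apply/seteqP; split => w /=.
  by move=> Bw; exists (marks PP N w) => //; rewrite -total_mark_marks mem_set.
by move=> [m _]; case: ifP => // + /= wm; rewrite total_mark_marks wm inE.
Qed.

(* The conditional probability of the marks m, given the points. *)
Definition marks_mass (m : seq nat) (w : Omega) : R :=
  \prod_(i < size m)
    poisson_mass (lam (nth 0 (sorted_points PP w) i)) (nth 0%N m i).

Lemma measurable_marks_mass m : measurable_fun setT (marks_mass m).
Proof.
apply: measurable_prod => i _; rewrite /poisson_mass.
have ml : measurable_fun setT (fun w => lam (nth 0 (sorted_points PP w) i)).
  by apply: measurableT_comp mlam _; exact: measurable_sorted_points.
apply: measurable_funM.
  by apply: measurable_funM => //; exact: measurable_funX.
by apply: measurableT_comp => //; exact: measurable_funN.
Qed.

Let nth01 w i : (i < size (PP w))%N -> 0 <= nth 0 (sorted_points PP w) i <= 1.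
Proof.
move=> iP; apply: (@PP01 w).
by rewrite -(mem_sort <=%R) mem_nth// size_sort.
Qed.

Let EFin_measurable_indic A : measurable A ->
  measurable_fun [set: Omega] (fun w => (\1_A w)%:E : \bar R).
Proof. by move=> mA; apply/measurable_EFinP; exact: measurable_indic. Qed.

Lemma marks_probability m :
  P [set w | marks PP N w = m] =
  (\int[P]_w ((marks_mass m w)%:E * (\1_[set w | size (PP w) = size m] w)%:E))%E.
Proof.
have [_ /(_ setT)] := hN m; rewrite !setTI => -> //; last first.
  (* The whole space is the event that the empty set carries no point. *)
  apply: sub_sigma_algebra; exists set0, 0%N; split; first exact: measurable0.
  apply/esym/seteqP; split => w //= _; rewrite /num_points (eq_count (a2 := pred0)) ?count_pred0// => x.
  by rewrite in_set0.
rewrite integral_mkcond; apply: eq_integral => w _.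
rewrite patchE; case: ifPn => [|wm]; last first.
  by rewrite /indic (negbTE wm) mule0.
rewrite inE/= => sm; rewrite /indic mem_set// mule1.
rewrite (big_nth (0, 0%N)) size_zip size_sort sm minnn big_mkord -prodEFin.
apply: eq_bigr => i _; rewrite nth_zip ?size_sort//=.
by rewrite Pois1// lam_ge0// nth01// sm.
Qed.

(** Both integrals are expanded over the countably many mark sequences. On the right, for given
    points, each factor is a Poisson generating function; the terms then agree by the conditional
    law of the marks. *)
Lemma total_mark_pgf z : 0 <= z ->
  (\int[P]_w (z ^+ total_mark PP N w)%:E =
   \int[P]_w (\prod_(x <- PP w) expR (lam x * (z - 1)))%:E)%E.
Proof.
move=> z0.
pose W (m : seq nat) w := ((z ^+ sumn m)%:E * (\1_[set w | marks PP N w = m] w)%:E)%E.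
pose V (m : seq nat) w := ((z ^+ sumn m)%:E * ((marks_mass m w)%:E *
   (\1_[set w | size (PP w) = size m] w)%:E))%E.
have V'0 m w : (0 <= (marks_mass m w)%:E *
   (\1_[set w | size (PP w) = size m] w)%:E)%E.
  have [sm|/eqP sm] := eqVneq (size (PP w)) (size m); last first.
    by rewrite /indic memNset ?mule0.
  rewrite mule_ge0// lee_fin; apply: prodr_ge0 => i _.
  by rewrite poisson_mass_ge0// lam_ge0// nth01// sm.
have mV' m : measurable_fun setT (fun w => (marks_mass m w)%:E *
   (\1_[set w | size (PP w) = size m] w)%:E)%E.
  apply: emeasurable_funM.
    by apply/measurable_EFinP; exact: measurable_marks_mass.
  by apply: EFin_measurable_indic; exact: measurable_size_points.
have mmarks m : measurable [set w | marks PP N w = m] by case: (hN m).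
have -> : (\int[P]_w (z ^+ total_mark PP N w)%:E =
    \int[P]_w (\esum_(m in [set: seq nat]) W m w))%E.
  apply: eq_integral => w _; rewrite (esum_one (v0 := marks PP N w))//.
  - by rewrite /W /indic mem_set// mule1 total_mark_marks.
  - by rewrite /W mule_ge0 ?lee_fin ?exprn_ge0.
  - by move=> m mm; rewrite /W /indic memNset ?mule0//= => /esym.
have -> : (\int[P]_w (\prod_(x <- PP w) expR (lam x * (z - 1)))%:E =
    \int[P]_w (\esum_(m in [set: seq nat]) V m w))%E.
  apply: eq_integral => w _.
  rewrite -(prod_sorted_points (fun x => expR (lam x * (z - 1)))).
  rewrite (big_nth 0) size_sort big_mkord -prodEFin.
  set k := size (PP w).
  pose x i := nth 0 (sorted_points PP w) i.
  pose f i j := (z ^+ j * poisson_mass (if (i < k)%N then lam (x i) else 0) j)%:E.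
  pose F i := expR ((if (i < k)%N then lam (x i) else 0) * (z - 1)).
  rewrite (eq_bigr (fun i : 'I_k => (F i)%:E)); last first.
    by move=> i _; rewrite /F ltn_ord.
  have lx i : 0 <= if (i < k)%N then lam (x i) else 0.
    by case: ifP => // ik; rewrite lam_ge0// nth01.
  rewrite -(@esum_seq_prod _ k f F); last 2 first.
  - by move=> i j; rewrite lee_fin mulr_ge0 ?exprn_ge0// poisson_mass_ge0.
  - by move=> i; rewrite esum_poisson_pgf.
  rewrite esum_mkcond; apply: eq_esum => m _; rewrite /V.
  have [sm|/eqP sm] := eqVneq (size m) k; last first.
    by rewrite memNset// /indic memNset ?mule0// => /esym.
  rewrite mem_set// /indic mem_set// mule1 /marks_mass sm -EFinM prodEFin; congr (_%:E).
  rewrite sumnE (big_nth 0%N) big_mkord sm -prodrXr.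
  rewrite -big_split/=; apply: eq_bigr => i _; by rewrite ltn_ord.
have -> : (\int[P]_w (\esum_(m in [set: seq nat]) W m w) =
    \esum_(m in [set: seq nat]) (\int[P]_w W m w))%E.
  apply: integral_esum => [m|m w].
    by apply: emeasurable_funM => //; exact: EFin_measurable_indic.
  by rewrite /W mule_ge0 ?lee_fin ?exprn_ge0.
have -> : (\int[P]_w (\esum_(m in [set: seq nat]) V m w) =
    \esum_(m in [set: seq nat]) (\int[P]_w V m w))%E.
  apply: integral_esum => [m|m w]; first exact: emeasurable_funM.
  by rewrite /V mule_ge0 ?V'0 ?lee_fin ?exprn_ge0.
apply: eq_esum => m _; rewrite /W integral_indicZl ?exprn_ge0//.
rewrite marks_probability /V ge0_integralZl_EFin ?exprn_ge0//.
Qed.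

End marks.

(** * The Laplace functional of the Poisson process *)

Section cells.
Variables (R : realType) (m : nat).
Let n : R := m.+1%:R.
Let n_gt0 : 0 < n. Proof. by rewrite ltr0n. Qed.

(** The cap at m puts x = 1 into the last cell, the only one closed on the right. *)
Definition cell_of (x : R) : 'I_m.+1 := inord (minn (Num.truncn (n * x)) m).

Definition cell (j : 'I_m.+1) : set R :=
  [set` Interval (BLeft (j%:R / n)) (BSide (j != ord_max) (j.+1%:R / n))].

Lemma cell_ofE (j : 'I_m.+1) x : cell j x <-> 0 <= x <= 1 /\ cell_of x = j.
Proof.
have jm : (j <= m)%N by rewrite -ltnS.
have cE : cell j x <-> (j%:R <= n * x) /\
    (if j != ord_max then n * x < j.+1%:R else n * x <= j.+1%:R).
  rewrite /cell /= itv_boundlr /= !bnd_simp ler_pdivrMr// mulrC.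
  case: ifP => _; rewrite bnd_simp.
    by rewrite ltr_pdivlMr// (mulrC x n); split=> [/andP//|[-> ->]].
  by rewrite ler_pdivlMr// (mulrC x n); split=> [/andP//|[-> ->]].
have nx01 : (0 <= x <= 1) = (0 <= n * x <= n).
  by rewrite pmulr_rge0// -ler_pdivlMl// mulVf ?gt_eqF.
have cofE : cell_of x = j <-> minn (Num.truncn (n * x)) m = j :> nat.
  rewrite /cell_of; split=> [<-|e]; first by rewrite inordK// ltnS geq_minr.
  by apply: val_inj; rewrite /= inordK// ltnS geq_minr.
rewrite cE cofE nx01; set y := n * x; clear cE cofE nx01.
have -> : (j != ord_max) = (j < m)%N by rewrite ltn_neqAle jm andbT.
have n_m : n = m%:R + 1 by rewrite /n natr1.
split=> [[jy]|[/andP[y0 yn]]].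
  have y0 : 0 <= y by rewrite (le_trans _ jy).
  have /andP[h1 h2] := truncn_itv y0.
  case: ltnP => [jm'|mj] yj.
    have jn : j.+1%:R <= n by rewrite ler_nat.
    split; first by rewrite y0/=; lra.
    have -> : Num.truncn y = j by apply/eqP; rewrite truncn_eq// jy yj.
    by apply/minn_idPl.
  have jE : j = m :> nat by lia.
  split; first by rewrite y0/= (le_trans yj)// ler_nat.
  rewrite jE; apply/minn_idPr; rewrite -ltnS -(ltr_nat R) (le_lt_trans _ h2)//.
  by rewrite -jE.
have /andP[h1 h2] := truncn_itv y0.
rewrite /minn; case: ltnP => [tm tj|mt mj].
  rewrite -tj tm; split=> //.
split; first by rewrite -mj (le_trans _ h1)// ler_nat.
by rewrite -mj ltnn.
Qed.

Lemma trivIset_cell : trivIset setT cell.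
Proof.
move=> i j _ _ [x [/cell_ofE[_ <-] /cell_ofE[_ <-]]]; reflexivity.
Qed.

Lemma lebesgue_measure_cell j : lebesgue_measure (cell j) = (n^-1)%:E.
Proof.
have lt : j%:R / n < j.+1%:R / n by rewrite ltr_pM2r ?invr_gt0// ltr_nat.
rewrite /cell lebesgue_measure_itv/= lte_fin lt -EFinB -mulrBl -natr1.
by rewrite (addrC j%:R) addrK mul1r.
Qed.

Lemma measurable_cell j : measurable (cell j).
Proof. exact: measurable_itv. Qed.

Lemma cell_sub j : cell j `<=` `[0, 1].
Proof. by move=> x /cell_ofE[x01 _]; rewrite /= in_itv. Qed.

Lemma dist_cell_of x : 0 <= x <= 1 -> `|x - (cell_of x)%:R / n| <= n^-1.
Proof.
move=> x01; have : cell (cell_of x) x by apply/cell_ofE.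
rewrite [leRHS](_ : n^-1 = (cell_of x).+1%:R / n - (cell_of x)%:R / n); last first.
  by rewrite -mulrBl -natr1 (addrC _%:R) addrK mul1r.
rewrite /cell/= itv_boundlr/= => /andP[]; rewrite !bnd_simp -/n => h1.
move: ((cell_of x).+1%:R / n) ((cell_of x)%:R / n) h1 => b a h1.
case: (_ != _); rewrite bnd_simp => h2; rewrite ger0_norm ?subr_ge0//; lra.
Qed.

End cells.

Section poisson_functional.
Context d (Omega : measurableType d) (R : realType) (P : probability Omega R).
Variables (PP : Omega -> {fset R}).
Hypothesis hPP : poisson_point_process P `[0, 1] 1 PP.

Let PP01 w x : x \in PP w -> 0 <= x <= 1.
Proof. by case: hPP => + _ _ _ => /[apply] /=; rewrite in_itv. Qed.

Lemma prod_cells m (c : 'I_m.+1 -> R) w :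
  \prod_(x <- PP w) c (cell_of m x) =
  \prod_(j < m.+1) c j ^+ num_points PP (@cell R m j) w.
Proof.
rewrite (partition_big (@cell_of R m) xpredT)//=; apply: eq_bigr => j _.
rewrite (eq_bigr (fun=> c j)) => [|x /eqP ->//].
rewrite big_const_seq -Monoid.iteropE; congr (_ ^+ _).
apply: eq_in_count => x /PP01 x01; apply/eqP/idP => [xj|].
  by rewrite mem_set//; apply/cell_ofE.
by rewrite inE => /cell_ofE[].
Qed.

Lemma measurable_prod_cells m (c : 'I_m.+1 -> R) :
  measurable_fun setT (fun w => \prod_(x <- PP w) c (cell_of m x)).
Proof.
rewrite (_ : (fun w => _) =
  (fun w => \prod_(j < m.+1) c j ^+ num_points PP (@cell R m j) w)); last first.
  by apply/funext => w; rewrite prod_cells.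
apply: measurable_prod => j _.
apply: (@measurable_discrete_comp _ _ _ _ _ (num_points PP (cell j)) (fun k => c j ^+ k)).
case: hPP => _ + _ _; apply; [exact: measurable_cell|exact: cell_sub].
Qed.

(** The numbers of points in the cells are independent Poisson variables of rate [m.+1%:R^-1], so
    their generating functions multiply. *)
Lemma integral_prod_cells m (c : nat -> R) : (forall j, 0 <= c j) ->
  (\int[P]_w (\prod_(x <- PP w) c (cell_of m x))%:E =
   (expR (m.+1%:R^-1 * \sum_(j < m.+1) (c j - 1)))%:E)%E.
Proof.
move=> c0; under eq_integral => w _ do rewrite (prod_cells (fun j : 'I_m.+1 => c j)).
rewrite mulr_sumr expR_sum.
apply: (@discrete_independent_expectation _ _ _ P _
  (fun j => num_points PP (@cell R m j)) (fun j k => c j ^+ k)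
  (fun j => expR (m.+1%:R^-1 * (c j - 1)))).
- by move=> i j; rewrite exprn_ge0.
- move=> j; case: hPP => _ + _ _; apply; [exact: measurable_cell|exact: cell_sub].
- case: hPP => _ _ _; apply.
  + exact: measurable_cell.
  + exact: cell_sub.
  + exact: trivIset_cell.
- move=> j; rewrite -esum_poisson_pgf//; apply: eq_esum => k _.
  rewrite EFinM; congr (_ * _)%E.
  case: hPP => _ _ -> //; last 3 first.
  + exact: measurable_cell.
  + exact: cell_sub.
  + by rewrite lebesgue_measure_cell ltry.
  by rewrite lebesgue_measure_cell/= mul1r Pois1.
Qed.

Variables (lam : R -> R) (u : R).
Hypothesis mlam : measurable_fun setT lam.
Hypothesis lam_ge0 : forall x, 0 <= x <= 1 -> 0 <= lam x.
Hypothesis lam_lip : forall x y, 0 <= x <= 1 -> 0 <= y <= 1 ->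
  `|lam x - lam y| <= `|x - y|.
Hypothesis u10 : -1 <= u <= 0.

Definition riemann_functional (n : nat) : R :=
  expR (n%:R^-1 * \sum_(i < n) (expR (u * lam (i%:R / n%:R)) - 1)).

Let h x := expR (lam x * u).
Let u_ge : -1 <= u. Proof. by case/andP: u10. Qed.
Let u_le : u <= 0. Proof. by case/andP: u10. Qed.

(** On the event of exactly k points the product is a finite one over the sorted points. *)
Lemma measurable_prod_points :
  measurable_fun setT (fun w => \prod_(x <- PP w) h x).
Proof.
pose g k w := \prod_(i < k) h (nth 0 (sorted_points PP w) i).
have mh : measurable_fun setT h.
  by apply: measurableT_comp => //; exact: measurable_funM.
have mg k : measurable_fun setT (g k).
  apply: measurable_prod => i _; apply: measurableT_comp => //.
  exact: measurable_sorted_points hPP _.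
move=> _ B mB; rewrite setTI.
rewrite (_ : _ @^-1` B = \bigcup_k ([set w | size (PP w) = k] `&` g k @^-1` B)).
  apply: bigcupT_measurable => k; apply: measurableI.
    exact: measurable_size_points hPP _.
  by rewrite -[_ @^-1` _]setTI; exact: mg.
have gE w : g (size (PP w)) w = \prod_(x <- PP w) h x.
  by rewrite -prod_sorted_points (big_nth 0) size_sort big_mkord.
apply/seteqP; split => w /= => [Bw|[k _ [/= <-]]]; last by rewrite gE.
by exists (size (PP w)) => //; split=> //=; rewrite gE.
Qed.

(** The value of [h] at the left end of cell j, with a slack e. The exponent of [h] varies by at
    most [m.+1%:R^-1] within a cell, so e = -1 and e = 1 give step functions below and above [h]. *)
Let c (e : R) (m j : nat) : R := expR (e / m.+1%:R) * expR (u * lam (j%:R / m.+1%:R)).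

Let exponent_dist x m : 0 <= x <= 1 ->
  `|lam x * u - u * lam ((cell_of m x)%:R / m.+1%:R)| <= m.+1%:R^-1.
Proof.
move=> x01; rewrite mulrC -mulrBr normrM.
have y01 : 0 <= ((cell_of m x)%:R / m.+1%:R : R) <= 1.
  rewrite mulr_ge0 ?invr_ge0//= ler_pdivrMr ?ltr0n// mul1r ler_nat ltnW//.
rewrite (le_trans _ (dist_cell_of m x01))// (le_trans _ (lam_lip x01 y01))//.
by rewrite ler_piMl// ler_norml u_ge (le_trans u_le).
Qed.

Let sum_h_le m : m.+1%:R^-1 * (\sum_(j < m.+1) expR (u * lam (j%:R / m.+1%:R))) <= 1.
Proof.
rewrite ler_pdivrMl ?ltr0n// mulr1 -[X in _ <= X%:R](card_ord m.+1) -sum1_card natr_sum.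
apply: ler_sum => j _; rewrite -[leRHS]expR0 ler_expR.
have y01 : 0 <= (j%:R / m.+1%:R : R) <= 1.
  rewrite mulr_ge0 ?invr_ge0//= ler_pdivrMr ?ltr0n// mul1r ler_nat ltnW//.
by rewrite mulr_le0_ge0 ?lam_ge0.
Qed.

Let sum_c e m : m.+1%:R^-1 * (\sum_(j < m.+1) (c e m j - 1)) =
  m.+1%:R^-1 * (\sum_(j < m.+1) (expR (u * lam (j%:R / m.+1%:R)) - 1)) +
  (expR (e / m.+1%:R) - 1) *
    (m.+1%:R^-1 * (\sum_(j < m.+1) expR (u * lam (j%:R / m.+1%:R)))).
Proof. by rewrite !sumrB -mulr_sumr; ring. Qed.

Lemma integral_prod_points_ge m :
  ((riemann_functional m.+1 * expR (expR (- 1 / m.+1%:R) - 1))%:E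
    <= \int[P]_w (\prod_(x <- PP w) h x)%:E)%E.
Proof.
apply: (@le_trans _ _ (\int[P]_w (\prod_(x <- PP w) c (- 1) m (cell_of m x))%:E)%E).
  rewrite integral_prod_cells => [|j]; last by rewrite mulr_ge0 ?expR_ge0.
  rewrite lee_fin /riemann_functional -expRD ler_expR sum_c lerD2l.
  have : expR (-1 / m.+1%:R) - 1 <= 0 :> R.
    by rewrite subr_le0 -[leRHS]expR0 ler_expR mulNr oppr_le0 mul1r invr_ge0.
  by move=> e0; rewrite -[leLHS]mulr1 ler_wnM2l.
apply: ge0_le_integral => //.
- by move=> w _; rewrite lee_fin; apply: prodr_ge0 => x _; rewrite mulr_ge0 ?expR_ge0.
- by apply/measurable_EFinP; exact: (measurable_prod_cells (fun j : 'I_m.+1 => c (-1) m j)).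
- by apply/measurable_EFinP; exact: measurable_prod_points.
move=> w _; rewrite lee_fin big_seq [leRHS]big_seq; apply: ler_prod => x xP.
rewrite mulr_ge0 ?expR_ge0//= /c -expRD ler_expR.
have := exponent_dist m (PP01 xP); rewrite ler_norml => /andP[? ?].
by rewrite mulNr mul1r -lerBrDr.
Qed.

Lemma integral_prod_points_le m :
  (\int[P]_w (\prod_(x <- PP w) h x)%:E <=
   (riemann_functional m.+1 * expR (expR (1 / m.+1%:R) - 1))%:E)%E.
Proof.
apply: (@le_trans _ _ (\int[P]_w (\prod_(x <- PP w) c 1 m (cell_of m x))%:E)%E); last first.
  rewrite integral_prod_cells => [|j]; last by rewrite mulr_ge0 ?expR_ge0.
  rewrite lee_fin /riemann_functional -expRD ler_expR sum_c lerD2l.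
  have : 0 <= expR (1 / m.+1%:R) - 1 :> R.
    by rewrite subr_ge0 -[leLHS]expR0 ler_expR mul1r invr_ge0.
  by move=> e0; rewrite -[leRHS]mulr1 ler_wpM2l.
apply: ge0_le_integral => //.
- by move=> w _; rewrite lee_fin; apply: prodr_ge0 => x _; rewrite expR_ge0.
- by apply/measurable_EFinP; exact: measurable_prod_points.
- by apply/measurable_EFinP; exact: (measurable_prod_cells (fun j : 'I_m.+1 => c 1 m j)).
move=> w _; rewrite lee_fin big_seq [leRHS]big_seq; apply: ler_prod => x xP.
rewrite expR_ge0/= /c -expRD ler_expR.
have := exponent_dist m (PP01 xP); rewrite ler_norml => /andP[? ?].
by rewrite mul1r -lerBlDr.
Qed.

(** The two bounds on G are solved for [riemann_functional], which is thereby squeezed between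
    multiples of G whose factors tend to 1. *)
Lemma cvg_riemann_functional (G : R) :
  (\int[P]_w (\prod_(x <- PP w) h x)%:E = G%:E)%E ->
  riemann_functional n @[n --> \oo] --> G.
Proof.
move=> GE; rewrite -cvg_shiftS /=.
have cvg_e (e : R) : G * expR (1 - expR (e / m.+1%:R)) @[m --> \oo] --> G.
  have e0 : G * expR (1 - expR (e * 0)) = G by rewrite mulr0 expR0 subrr expR0 mulr1.
  rewrite -[X in _ --> X]e0; apply: cvgM; first exact: cvg_cst.
  apply: continuous_cvg; first exact: continuous_expR.
  apply: cvgB; first exact: cvg_cst.
  apply: continuous_cvg; first exact: continuous_expR.
  by apply: cvgM; [exact: cvg_cst|exact: cvg_harmonic].
apply: squeeze_cvgr (cvg_e 1) (cvg_e (- 1)); near=> m.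
have := integral_prod_points_ge m; have := integral_prod_points_le m.
rewrite GE !lee_fin => h1 h2; apply/andP; split.
  rewrite -[1 - _]opprB expRN ler_pdivrMr ?expR_gt0//.
by rewrite -[1 - _]opprB expRN ler_pdivlMr ?expR_gt0.
Unshelve. all: by end_near.
Qed.

End poisson_functional.

(** * Generating functions and convergence in law *)

Section pgf.
Variable R : realType.

Lemma cvg_sumr (I T : Type) (F : set_system T) (FF : Filter F) (s : seq I)
    (f : I -> T -> R) (l : I -> R) :
  (forall i, f i x @[x --> F] --> l i) ->
  \sum_(i <- s) f i x @[x --> F] --> \sum_(i <- s) l i.
Proof.
move=> fl; elim: s => [|i s IH]; rewrite ?big_nil ?big_cons.
  by under eq_fun do rewrite big_nil; exact: cvg_cst.
by under eq_fun do rewrite big_cons; exact: cvgD.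
Qed.

(** What is retained of g being the generating function of p at z, in finite sums only: the masses
    beyond k contribute between 0 and [z ^+ k.+1]. *)
Definition pgf_bounds (p : nat -> R) (z g : R) : Prop :=
  forall k, \sum_(j < k.+1) p j * z ^+ j <= g <= \sum_(j < k.+1) p j * z ^+ j + z ^+ k.+1.

(* Once the first k masses converge, [p_n k * z ^+ k] is pinned down up to
   [z ^+ k.+1] by the values of the generating functions at z. *)
Lemma pgf_continuity (p : nat -> nat -> R) (g : nat -> R -> R)
    (q : nat -> R) (h : R -> R) :
  (forall z, 0 < z < 1 -> \forall n \near \oo, pgf_bounds (p n) z (g n z)) ->
  (forall z, 0 < z < 1 -> pgf_bounds q z (h z)) ->
  (forall z, 0 < z < 1 -> g n z @[n --> \oo] --> h z) ->
  forall k, p n k @[n --> \oo] --> q k.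
Proof.
move=> pg qh gh k; elim/ltn_ind: k => k IH.
apply/cvgrPdist_lt => e e0.
(* The error in [p n k * z ^+ k] will be below [3 * z ^+ k.+1]; division by [z ^+ k] leaves
   [3 * z <= e]. *)
pose z := Num.min (1 / 2) (e / 3).
have z0 : 0 < z by rewrite lt_min; apply/andP; split; [lra|rewrite divr_gt0].
have z1 : z < 1 by rewrite gt_min; apply/orP; left; lra.
have ze : 3 * z <= e.
  by rewrite mulrC -ler_pdivlMr// ge_min lexx orbT.
have z01 : 0 < z < 1 by rewrite z0 z1.
have zk0 : 0 < z ^+ k by rewrite exprn_gt0.
have zk1 : 0 < z ^+ k.+1 by rewrite exprn_gt0.
have cH : (g n z - \sum_(j < k) p n j * z ^+ j) @[n --> \oo] -->
    h z - \sum_(j < k) q j * z ^+ j.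
  apply: cvgB; first exact: gh.
  apply: cvg_sumr => j; apply: cvgM; last exact: cvg_cst.
  exact: IH.
move/cvgrPdist_lt/(_ _ zk1): cH => cH.
near=> n.
have /(_ k) : pgf_bounds (p n) z (g n z) by near: n; exact: pg.
have := qh _ z01 k.
have : `|h z - \sum_(j < k) q j * z ^+ j - (g n z - \sum_(j < k) p n j * z ^+ j)| < z ^+ k.+1.
  by near: n.
rewrite !big_ord_recr/=; set A := \sum_(j < k) _; set B := \sum_(j < k) _.
rewrite ltr_norml => /andP[h1 h2] /andP[h3 h4] /andP[h5 h6].
rewrite -(ltr_pM2r zk0) -[X in _ * X < _](gtr0_norm zk0) -normrM mulrBl.
have : 3 * z ^+ k.+1 <= e * z ^+ k by rewrite exprS mulrA ler_wpM2r// ltW.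
move: (z ^+ k.+1) (q k * z ^+ k) (p n k * z ^+ k) (e * z ^+ k) zk1 h1 h2 h3 h4 h5 h6.
move: A B (h z) (g n z) => A B H G x1 x2 x3 x4 *.
by rewrite ltr_norml; apply/andP; split; lra.
Unshelve. all: by end_near.
Qed.

Section probability.
Context d (Omega : measurableType d) (P : probability Omega R).
Variable X : Omega -> nat.
Hypothesis mX : discrete_measurable_fun X.

Definition mass (j : nat) : R := fine (P [set w | X w = j]).

Let mXj j : measurable [set w | X w = j].
Proof. exact: (mX [set j]). Qed.

Lemma integral_truncated_pgf (z : R) k : 0 <= z ->
  (\int[P]_w (\sum_(j < k) (\1_[set w | X w = j] w) * z ^+ j)%:E =
   (\sum_(j < k) mass j * z ^+ j)%:E)%E.
Proof.
move=> z0; under eq_integral => w _ do rewrite -sumEFin.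
rewrite ge0_integral_sum//.
- rewrite -sumEFin; apply: eq_bigr => j _.
  under eq_integral => w _ do rewrite EFinM muleC.
  rewrite integral_indicZl ?exprn_ge0// /mass EFinM muleC fineK//.
  exact: fin_num_measure.
- move=> j; apply/measurable_EFinP; exact: measurable_funM.
- by move=> j w _; rewrite lee_fin mulr_ge0 ?exprn_ge0.
Qed.

Lemma measurable_pow_comp (z : R) : measurable_fun setT (fun w => z ^+ X w).
Proof. exact: (measurable_discrete_comp (fun j => z ^+ j) mX). Qed.

Lemma pgf_boundsP (z g : R) : 0 < z < 1 ->
  (\int[P]_w (z ^+ X w)%:E = g%:E)%E -> pgf_bounds mass z g.
Proof.
move=> /andP[z0 z1] gE k.
have z0' := ltW z0.
pose S w := \sum_(j < k.+1) (\1_[set w | X w = j] w) * z ^+ j.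
have mS : measurable_fun setT S.
  apply: measurable_sum => j; exact: measurable_funM.
have S0 w : 0 <= S w by apply: sumr_ge0 => j _; rewrite mulr_ge0 ?exprn_ge0.
have SE w : S w = if (X w < k.+1)%N then z ^+ X w else 0.
  rewrite /S; case: ifPn => [Xk|Xk].
    rewrite (bigD1 (Ordinal Xk))//= big1 ?addr0 => [|j jX].
      by rewrite /indic mem_set// mul1r.
    rewrite /indic memNset ?mul0r//= => Xj.
    by move: jX; rewrite -val_eqE/= -Xj eqxx.
  rewrite big1// => j _; rewrite /indic memNset ?mul0r//= => Xj.
  by move: Xk; rewrite Xj ltn_ord.
have := integral_truncated_pgf k.+1 z0'; rewrite -/S => IS.
rewrite -!lee_fin EFinD -IS -gE; apply/andP; split.
  apply: ge0_le_integral => //.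
  - by move=> w _; rewrite lee_fin; exact: S0.
  - exact/measurable_EFinP.
  - by apply/measurable_EFinP; exact: measurable_pow_comp.
  - by move=> w _; rewrite lee_fin -/(S w) SE; case: ifP => // _; rewrite exprn_ge0.
have -> : ((z ^+ k.+1)%:E = \int[P]_w (z ^+ k.+1)%:E)%E.
  by rewrite integral_cst// -[LHS]mule1; congr (_ * _)%E; apply/esym; exact: probability_setT.
rewrite -ge0_integralD//.
- apply: ge0_le_integral => //.
  + by move=> w _; rewrite lee_fin exprn_ge0.
  + by apply/measurable_EFinP; exact: measurable_pow_comp.
  + by apply: emeasurable_funD => //; exact/measurable_EFinP.
  + move=> w _; rewrite -EFinD lee_fin -/(S w) SE; case: ltnP => Xk.
      by rewrite lerDl exprn_ge0.
    by rewrite add0r ler_wiXn2l// ltW.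
- by move=> w _; rewrite lee_fin; exact: S0.
- exact/measurable_EFinP.
- by move=> w _; rewrite lee_fin exprn_ge0.
Qed.

(** For an integer-valued variable the distribution function is a finite sum of masses, so
    convergence of masses carries over. *)
Lemma cdf_mass (t : R) :
  P [set w | (X w)%:R <= t] =
  (if 0 <= t then \sum_(j < (Num.truncn t).+1) mass j else 0)%:E.
Proof.
case: ifPn => [t0|t0]; last first.
  rewrite (_ : [set w | _] = set0) ?measure0//; apply/seteqP; split=> // w /= Xt.
  by case/negP: t0; rewrite (le_trans _ Xt).
have mt : measurable [set w | (X w)%:R <= t] by exact: (mX [set j | j%:R <= t]).
have := integral_truncated_pgf (Num.truncn t).+1 (@ler01 R).
under [in X in _ = X -> _]eq_bigr do rewrite expr1n mulr1.
move=> <-; rewrite -[in LHS](setIT [set w | _]) -integral_indic//.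
apply: eq_integral => w _; congr (_%:E).
have := truncn_itv t0 => /andP[t1 t2].
have XtE : ((X w)%:R <= t) = (X w < (Num.truncn t).+1)%N.
  apply/idP/idP => [Xt|Xt]; first by rewrite -(ltr_nat R) (le_lt_trans Xt).
  by rewrite (le_trans _ t1)// ler_nat.
rewrite /indic; have [Xk|Xk] := ltnP (X w) (Num.truncn t).+1.
  rewrite mem_set/= ?XtE// (bigD1 (Ordinal Xk))//= big1 ?addr0 => [|j jX].
    by rewrite mem_set// mul1r expr1n.
  rewrite memNset ?mul0r//= => Xj.
  by move: jX; rewrite -val_eqE/= -Xj eqxx.
rewrite memNset => [|/=]; last by rewrite XtE ltnNge Xk.
rewrite big1// => j _; rewrite memNset ?mul0r//= => Xj.
by move: Xk; rewrite Xj leqNgt ltn_ord.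
Qed.

End probability.

End pgf.

(** * The exponents and the random colouring *)

Section lambda.
Variables (R : realType) (r : nat) (s : 'I_r).
Implicit Types x y : R.

Lemma measurable_lambda : measurable_fun setT (@lambda R r s).
Proof.
have m1 : measurable_fun setT (fun x : R => (1 - x) / (r.-1 - s)%:R).
  by apply: measurable_funM => //; exact: measurable_funB.
have m2 : measurable_fun setT (fun x : R => x / s%:R).
  by apply: measurable_funM.
have [s0|s0] := eqVneq (s : nat) 0%N.
  rewrite (_ : @lambda R r s = fun x : R => (1 - x) / (r.-1 - s)%:R)//.
  by apply/funext => x; rewrite /lambda s0 eqxx.
have [s1|s1] := eqVneq (s : nat) r.-1.
  rewrite (_ : @lambda R r s = fun x : R => x / s%:R)//.
  by apply/funext => x; rewrite /lambda (negbTE s0) s1 eqxx.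
rewrite (_ : @lambda R r s = (fun x : R => x / s%:R) \min
   (fun x : R => (1 - x) / (r.-1 - s)%:R)).
  exact: measurable_minr.
by apply/funext => x; rewrite /lambda (negbTE s0) (negbTE s1).
Qed.

Lemma lambda_ge0 x : 0 <= x <= 1 -> 0 <= lambda s x.
Proof.
move=> /andP[x0 x1]; rewrite /lambda.
case: ifP => _; first by rewrite mulr_ge0 ?subr_ge0 ?invr_ge0.
case: ifP => _; first by rewrite mulr_ge0 ?invr_ge0.
by rewrite le_min !mulr_ge0 ?subr_ge0 ?invr_ge0.
Qed.

(** The slopes are inverses of natural numbers, hence at most 1 in absolute value, and a minimum
    preserves the Lipschitz constant. *)
Lemma lambda_lip x y : `|lambda s x - lambda s y| <= `|x - y|.
Proof.
have inv1 (k : nat) : `|k%:R^-1| <= 1 :> R.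
  case: k => [|k]; first by rewrite invr0 normr0.
  by rewrite ger0_norm ?invr_ge0// invf_le1 ?ltr0n// ler1n.
have l1 : `|(1 - x) / (r.-1 - s)%:R - (1 - y) / (r.-1 - s)%:R| <= `|x - y|.
  rewrite -mulrBl normrM; have -> : 1 - x - (1 - y) = - (x - y) by ring.
  by rewrite normrN ler_piMr.
have l2 : `|x / s%:R - y / s%:R| <= `|x - y|.
  by rewrite -mulrBl normrM ler_piMr.
rewrite /lambda; case: ifP => // _; case: ifP => // _.
move: l1 l2; move: (`|x - y|) (x / _) (y / _) ((1 - x) / _) ((1 - y) / _) => z a b c e.
rewrite !ler_norml => /andP[? ?] /andP[? ?].
by case: (leP a c) => ?; case: (leP b e) => ?; apply/andP; split; lra.
Qed.

End lambda.

Section exponents.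
Variables (R : realType) (c r : nat) (a : 'I_r -> 'I_c.-1) (theta : 'I_c.-1 -> R).
Hypothesis theta_gt0 : forall b, 0 < theta b.
Hypothesis theta_sum :
  \sum_(b in palette_colors a) (multiplicity a b)%:R * theta b = 2.
Hypothesis theta_max1 : theta_max theta a = 1.
Hypothesis r_ge3 : (3 <= r)%N.
Variable shat : 'I_r.
Hypothesis hshat : rare_coordinate theta a shat.

Lemma sum_theta : \sum_s theta (a s) = 2.
Proof.
rewrite -theta_sum (partition_big a (fun b => b \in palette_colors a))/= => [|s _].
  apply: eq_bigr => b _; rewrite (eq_bigr (fun=> theta b)) => [|s /eqP ->//].
  by rewrite sumr_const mulr_natl.
by rewrite inE codom_f.
Qed.

Lemma theta_rare : theta (a shat) = 1.
Proof. by rewrite hshat. Qed.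

(** Two coordinates of the rare colour already exhaust the total 2, while a third coordinate has a
    positive exponent. *)
Lemma rare_unique s : s != shat -> a s != a shat.
Proof.
move=> ss; apply/eqP => aa; have := sum_theta.
rewrite (bigD1 shat)//= (bigD1 s)//= aa theta_rare.
have [s2 /andP[s2h s2s]] : exists s2 : 'I_r, (s2 != shat) && (s2 != s).
  have : (0 < #|[set~ shat] :\ s|)%SET%N.
    have := cardsC1 shat; rewrite card_ord (cardsD1 s) !inE ss.
    by lia.
  by rewrite card_gt0 => /set0Pn[s1]; rewrite !inE => /andP[? ?]; exists s1; apply/andP.
rewrite (bigD1 s2) ?s2h//=.
set S := \sum_(i | _) _; have : 0 <= S by apply: sumr_ge0 => i _; exact: ltW.
by have := theta_gt0 (a s2); lra.
Qed.

Lemma exists_theta_lb : exists2 delta : R, 0 < delta & forall s, delta <= theta (a s).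
Proof.
case: (@arg_minP _ R _ shat xpredT (fun s => theta (a s)) isT) => s0 _ s0P.
by exists (theta (a s0)) => // s; exact: s0P.
Qed.

Lemma color_prob_admissible n s :
  color_prob theta n (admissible_palette a s) = n%:R `^ (- theta (a s)).
Proof.
rewrite /color_prob /admissible_palette.
by rewrite (_ : val (widen_ord _ _) = val (a s))// valK.
Qed.

Lemma prod_color_prob n : (0 < n)%N ->
  \prod_s color_prob theta n (admissible_palette a s) = n%:R ^- 2.
Proof.
move=> n0; have n1 : n%:R != 0 :> R by rewrite pnatr_eq0 -lt0n.
under eq_bigr do rewrite color_prob_admissible /powR (negbTE n1).
rewrite -expR_sum -mulr_suml sumrN sum_theta mulNr expRN expRM_natl.
by rewrite lnK// posrE ltr0n.
Qed.

End exponents.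

Lemma sum_color_prob (R : realType) c (theta : 'I_c.-1 -> R) n : (0 < c)%N ->
  \sum_b color_prob theta n b = 1.
Proof.
case: c theta => // c theta _; rewrite big_ord_recr/=.
rewrite {2}/color_prob /= insubF ?ltnn//.
rewrite (eq_bigr (fun b' : 'I_c => n%:R `^ (- theta b'))); first by rewrite addrC subrK.
by move=> b _; rewrite /color_prob (_ : val (widen_ord _ _) = val b)// valK.
Qed.

Section coloring.
Context d (Omega : measurableType d) (R : realType) (P : probability Omega R).
Variables (c r n : nat) (theta : 'I_c.-1 -> R) (phi : Omega -> 'I_n -> 'I_c).
Hypothesis hphi : random_coloring P theta phi.
Variable a : 'I_r -> 'I_c.

Let coloring w : {ffun 'I_n -> 'I_c} := [ffun i => phi w i].

Lemma num_colorful_APsE w :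
  num_colorful_APs (phi w) a = #|colorful_APs a (coloring w)|.
Proof.
apply: eq_card => t; rewrite [LHS]inE [RHS]inE.
apply/asboolP/andP => [[tA tc]|[/APsP tA /forallP tc]].
  by split; [exact/APsP|apply/forallP => s; rewrite ffunE tc].
by split=> // s; have := tc s; rewrite ffunE => /eqP.
Qed.

Let coloringE f : [set w | coloring w = f] =
  \bigcap_(i in [set` [set: 'I_n]%SET]) (phi^~ i) @^-1` [set f i].
Proof.
apply/seteqP; split => w /=; first by move=> <- i _; rewrite /= ffunE.
by move=> wf; apply/ffunP => i; rewrite ffunE; apply: (wf i); rewrite /= inE.
Qed.

Lemma measurable_coloring f : measurable [set w | coloring w = f].
Proof.
case: hphi => mphi _ _; rewrite coloringE.
by apply: fin_bigcap_measurable => [|i _]; [exact: finite_finset|exact: mphi].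
Qed.

Lemma coloring_mass f :
  P [set w | coloring w = f] = (product_mass (color_prob theta n) f)%:E.
Proof.
case: hphi => _ pphi indphi; rewrite coloringE indphi -prodEFin.
by rewrite big_mkcond/=; apply: eq_bigr => i _; rewrite inE pphi.
Qed.

Lemma measurable_num_colorful_APs :
  discrete_measurable_fun (fun w => num_colorful_APs (phi w) a).
Proof.
move=> B; rewrite (_ : _ @^-1` B =
  \bigcup_(f in [set f | B #|colorful_APs a f|]) [set w | coloring w = f]).
  by apply: fin_bigcup_measurable => [|f _]; [exact: finite_finset|exact: measurable_coloring].
apply/seteqP; split => w /=; rewrite num_colorful_APsE.
  by move=> Bw; exists (coloring w).
by move=> [f Bf /= ->].
Qed.

Lemma integral_num_colorful_APs z : 0 <= z ->
  (\int[P]_w (z ^+ num_colorful_APs (phi w) a)%:E =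
   (colorful_pgf n (color_prob theta n) a z)%:E)%E.
Proof.
move=> z0.
transitivity (\int[P]_w \sum_(f : {ffun 'I_n -> 'I_c})
   (z ^+ #|colorful_APs a f|)%:E * (\1_[set w | coloring w = f] w)%:E)%E.
  apply: eq_integral => w _; rewrite num_colorful_APsE (bigD1 (coloring w))//=.
  rewrite /indic mem_set// mule1 big1 ?adde0// => f fw.
  by rewrite memNset ?mule0//= => wf; rewrite wf eqxx in fw.
rewrite ge0_integral_sum//.
- rewrite /colorful_pgf -sumEFin; apply: eq_bigr => f _.
  rewrite integral_indicZl ?exprn_ge0//; last exact: measurable_coloring.
  by rewrite EFinM muleC coloring_mass.
- move=> f; apply: emeasurable_funM => //; apply/measurable_EFinP.
  by apply: measurable_indic; exact: measurable_coloring.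
- by move=> f w _; rewrite mule_ge0 ?lee_fin ?exprn_ge0.
Qed.

(** The last colour has probability one minus a sum, which for small n may be negative; it is
    nonnegative here because some position takes each colour with the stated probability. *)
Lemma color_prob_ge0 b : (0 < n)%N -> 0 <= color_prob theta n b.
Proof.
by move=> n0; case: hphi => _ /(_ (Ordinal n0) b) pb _; rewrite -lee_fin -pb.
Qed.

End coloring.

(** * Conclusion *)

Lemma cvg_powRN (R : realType) (delta : R) : 0 < delta ->
  n%:R `^ (- delta) @[n --> \oo] --> (0 : R).
Proof.
move=> d0; rewrite -cvg_shiftS/=.
have -> : (fun n => n.+1%:R `^ (- delta)) = (fun n => (n.+1%:R^-1 : R) `^ delta).
  by apply/funext => n; rewrite -powR_inv1// -powRrM mulN1r.
have := powR_cvg0 d0 => /cvg_at_rightP/(_ (fun n => n.+1%:R^-1)); apply; split.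
  by move=> n; rewrite invr_gt0 ltr0n.
exact: cvg_harmonic.
Qed.

Lemma colorful_pgf_cvg (R : realType) (c r : nat) (hc : (0 < c)%N) (hr : (3 <= r)%N)
    (a : 'I_r -> 'I_c.-1) (theta : 'I_c.-1 -> R)
    (theta_gt0 : forall b, 0 < theta b)
    (theta_sum :
      \sum_(b in palette_colors a) (multiplicity a b)%:R * theta b = 2)
    (theta_max1 : theta_max theta a = 1)
    (shat : 'I_r) (hshat : rare_coordinate theta a shat)
    (prob_ge0 : \forall n \near \oo, forall b : 'I_c, 0 <= color_prob theta n b)
    (u G : R) : -1 <= u <= 0 ->
  riemann_pgf shat n u @[n --> \oo] --> G ->
  colorful_pgf n (color_prob theta n) (admissible_palette a) (1 + u)
    @[n --> \oo] --> G.
Proof.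
move=> u10 rG; have [delta d0 dP] := @exists_theta_lb R c r a theta theta_gt0 shat.
apply/cvgrPdist_lt => e e0.
have e4 : 0 < e / 4 by rewrite divr_gt0.
have B0 : 0 < 2 * expR (expR (4 : R)) by rewrite mulr_gt0 ?expR_gt0.
(* J comes from the tail alone; n is taken large afterwards, because [K] below depends on J. *)
have [J JP] : exists J, 2 * (4 ^- J * expR (expR (4 : R))) < e / 4.
  have : `|4^-1 : R| < 1 by rewrite ger0_norm ?invr_ge0// invf_lt1//; lra.
  move=> /cvg_expr/cvgrPdist_lt/(_ (e / 4 / (2 * expR (expR 4))))[].
    by rewrite divr_gt0.
  move=> J _ /(_ J (leqnn J)); rewrite /= sub0r normrN ger0_norm ?exprn_ge0 ?invr_ge0//.
  rewrite ltr_pdivlMr// exprVn => JP; exists J.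
  by rewrite mulrCA.
set K := \sum_(j < J.+1) clash_bound R r j.
have cK : K * n%:R `^ (- delta) @[n --> \oo] --> K * 0.
  by apply: cvgM; [exact: cvg_cst|exact: cvg_powRN].
have c4 : 4 * n%:R^-1 @[n --> \oo] --> (4 * 0 : R).
  apply: cvgM; first exact: cvg_cst.
  by rewrite -cvg_shiftS/=; exact: cvg_harmonic.
move/cvgrPdist_lt: cK => /(_ _ e4) cK; move/cvgrPdist_lt: c4 => /(_ _ e4) c4.
move/cvgrPdist_lt: rG => /(_ _ e4) rG.
near=> n.
have n0 : (0 < n)%N by near: n; exists 1%N.
have n1 : 1 <= n%:R :> R by rewrite ler1n.
have pge0 : forall b : 'I_c, 0 <= color_prob theta n b by near: n.
have := @colorful_riemann_dist R n r 'I_c (color_prob theta n)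
  (admissible_palette a) n0 hr (n%:R `^ (- delta)) shat pge0 _ _ _ _ _ _ u J u10.
rewrite -/K => main.
have : `|G - riemann_pgf shat n u| < e / 4 by near: n.
have : `|K * 0 - K * n%:R `^ (- delta)| < e / 4 by near: n.
have : `|4 * 0 - 4 * n%:R^-1| < e / 4 by near: n.
rewrite !mulr0 !sub0r !normrN => h1 h2 h3.
have {h1} h1 := le_lt_trans (ler_norm _) h1.
have {h2} h2 := le_lt_trans (ler_norm _) h2.
have {}main : `|colorful_pgf n (color_prob theta n) (admissible_palette a) (1 + u) -
    riemann_pgf shat n u| <=
    K * n%:R `^ (- delta) + 2 * (4 ^- J * expR (expR 4)) + 4 / n%:R.
  apply: main.
  - by move=> s; rewrite color_prob_admissible ler_powR// lerN2.
  - by rewrite -[leRHS](powRr0 n%:R) ler_powR// oppr_le0 ltW.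
  - exact: prod_color_prob.
  - by rewrite color_prob_admissible (theta_rare theta_max1 hshat) powR_inv1.
  - move=> s ss; have := rare_unique theta_gt0 theta_sum theta_max1 hr hshat ss.
    by apply: contraNneq => /(congr1 val) aa; apply/eqP/val_inj.
  - exact: sum_color_prob.
move: main JP h1 h2 h3.
move: (colorful_pgf _ _ _ _) (riemann_pgf _ _ _) (K * _) (2 * _) (4 / _) => x1 x2 x3 x4 x5.
rewrite ler_norml !ltr_norml => /andP[? ?] ? ? ? /andP[? ?].
by apply/andP; split; lra.
Unshelve. all: by end_near.
Qed.

Lemma exists_integral_pow d (Omega : measurableType d) (R : realType)
    (P : probability Omega R) (X : Omega -> nat) (z : R) :
  discrete_measurable_fun X -> 0 <= z <= 1 ->
  exists g : R, (\int[P]_w (z ^+ X w)%:E = g%:E)%E.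
Proof.
move=> mX /andP[z0 z1]; exists (fine (\int[P]_w (z ^+ X w)%:E)).
have I0 : (0 <= \int[P]_w (z ^+ X w)%:E)%E.
  by apply: integral_ge0 => w _; rewrite lee_fin exprn_ge0.
rewrite fineK// ge0_fin_numE// (@le_lt_trans _ _ 1%E) ?ltry//.
rewrite -(@probability_setT _ _ _ P) -[leRHS]mul1e -integral_cst//.
apply: ge0_le_integral => //.
- by move=> w _; rewrite lee_fin exprn_ge0.
- by apply/measurable_EFinP; exact: measurable_pow_comp.
- by move=> w _; rewrite lee_fin exprn_ile1.
Qed.

Theorem theorem2p9 (R : realType) (c r : nat) (hc : (2 <= c)%N) (hr : (3 <= r)%N)
    (a : 'I_r -> 'I_c.-1) (theta : 'I_c.-1 -> R)
    (theta_gt0 : forall b, 0 < theta b)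
    (theta_sum :
      \sum_(b in palette_colors a) (multiplicity a b)%:R * theta b = 2)
    (theta_max1 : theta_max theta a = 1)
    (shat : 'I_r) (hshat : rare_coordinate theta a shat)
    (d : nat -> measure_display) (Omega : forall n, measurableType (d n))
    (P : forall n, probability (Omega n) R)
    (phi : forall n, Omega n -> 'I_n -> 'I_c)
    (hphi : \forall n \near \oo, random_coloring (P n) theta (phi n))
    (d' : measure_display) (Omega' : measurableType d')
    (P' : probability Omega' R)
    (PP : Omega' -> {fset R}) (N : Omega' -> R -> nat)
    (hPP : poisson_point_process P' `[0, 1] 1 PP)
    (hN : cond_independent_poisson_marks P' (lambda shat) PP N) :
  cvg_in_distribution P
    (fun n w => (num_colorful_APs (phi n w) (admissible_palette a))%:R)
    P' (fun w => (total_mark PP N w)%:R).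
Proof.
have mX : \forall n \near \oo, discrete_measurable_fun
    (fun w => num_colorful_APs (phi n w) (admissible_palette a)).
  near=> n; apply: (@measurable_num_colorful_APs _ _ _ (P n)).
  by near: n; exact: hphi.
have mY : discrete_measurable_fun (total_mark PP N) := measurable_total_mark hN.
pose p n := mass (P n) (fun w => num_colorful_APs (phi n w) (admissible_palette a)).
pose q := mass P' (total_mark PP N).
pose h z := fine (\int[P']_w (z ^+ total_mark PP N w)%:E)%E.
have hE z : 0 < z < 1 -> (\int[P']_w (z ^+ total_mark PP N w)%:E = (h z)%:E)%E.
  move=> /andP[z0 z1]; rewrite /h.
  by have [|g ->] := exists_integral_pow P' mY (z := z); rewrite ?ltW.
have prob_ge0 : \forall n \near \oo, forall b : 'I_c, 0 <= color_prob theta n b.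
  near=> n => b; apply: (@color_prob_ge0 _ _ _ (P n) _ _ _ (phi n)).
    by near: n; exact: hphi.
  by near: n; exists 1%N.
have pq : forall k, p n k @[n --> \oo] --> q k.
  apply: (@pgf_continuity _ p (fun n z =>
    colorful_pgf n (color_prob theta n) (admissible_palette a) z) q h).
  - move=> z z01; near=> n; apply: pgf_boundsP => //.
      by near: n.
    apply: integral_num_colorful_APs; first by near: n; exact: hphi.
    by case/andP: z01 => /ltW.
  - by move=> z z01; apply: pgf_boundsP => //; exact: hE.
  - move=> z z01; have /andP[z0 z1] := z01.
    (* With u = z - 1, the points 0 < z < 1 fall in the range where the truncated binomial
       expansions are controlled. *)
    have u10 : -1 <= z - 1 <= 0 by apply/andP; split; lra.
    have zE : 1 + (z - 1) = z by rewrite addrC subrK.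
    suff : colorful_pgf n (color_prob theta n) (admissible_palette a) (1 + (z - 1))
        @[n --> \oo] --> h z by rewrite zE.
    apply: (colorful_pgf_cvg (ltnW hc) hr theta_gt0 theta_sum theta_max1 hshat prob_ge0 u10).
    have IE : (\int[P']_w (\prod_(x <- PP w) expR (lambda shat x * (z - 1)))%:E
        = (h z)%:E)%E.
      rewrite -hE// (total_mark_pgf hPP _ _ hN) ?ltW//.
        exact: measurable_lambda.
      exact: lambda_ge0.
    apply: (cvg_riemann_functional hPP _ _ _ u10 IE).
    + exact: measurable_lambda.
    + exact: lambda_ge0.
    + by move=> x y _ _; exact: lambda_lip.
split.
- near=> n; apply: (measurable_discrete_comp (fun k => k%:R : R)).
  by near: n.
- exact: (measurable_discrete_comp (fun k => k%:R : R)).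
- move=> t _; rewrite (cdf_mass P' mY).
  apply: cvg_EFin.
    near=> n; rewrite cdf_mass//; by near: n.
  apply: (@cvg_trans _ ((fun n => if 0 <= t then
      \sum_(j < (Num.truncn t).+1) p n j else 0) @ \oo)).
    apply: near_eq_cvg; near=> n; rewrite /= cdf_mass//; by near: n.
  case: ifP => _; last exact: cvg_cst.
  by apply: cvg_sumr => j; exact: pq.
Unshelve. all: by end_near.
Qed.
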